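(* Let $d$ be a positive integer. If $X$ is a block gluing $\mathbb{Z}^d$ subshift, $Y$ is a $\mathbb{Z}^d$ shift of finite type with a fixed point and the finite extension property, and $h(X) > h(Y)$, then there exists a (topological) factor map from $X$ onto $Y$.
   Context: Distance in $\mathbb{Z}^d$ is the $\ell_\infty$ distance $d((v_i),(w_i)) = \max_i |v_i-w_i|$, and for $A,B\subset\mathbb{Z}^d$, $d(A,B)=\min_{a\in A,b\in B} d(a,b)$. For $k\ge 0$, $C_k=[0,k-1]^d$ and $Q_k=[-k,k]^d$ (integer points). A pattern over a finite alphabet $\mathcal{A}$ is an element $w$ of $\mathcal{A}^S$ for some $S\subset\mathbb{Z}^d$, called its shape; it is a finite pattern if $S$ is finite. Patterns are considered up to translation: $u\in\mathcal{A}^S$ and $v\in\mathcal{A}^{S+t}$ are identified if $u(s)=v(s+t)$ for all $s\in S$. Thus a pattern contains a pattern $w$ if one of its restrictions equals $w$ up to translation. The shift action on $\mathcal{A}^{\mathbb{Z}^d}$ is $(\sigma_t x)(s)=x(s+t)$ for $s,t\in\mathbb{Z}^d$. A $\mathbb{Z}^d$ subshift is a subset $X\subset\mathcal{A}^{\mathbb{Z}^d}$ ($\mathcal{A}$ a finite alphabet) that is closed in the product of discrete topologies and invariant under all $\sigma_t$. For a set $\mathcal{F}$ of finite patterns, $X(\mathcal{F})$ is the set of $x\in\mathcal{A}^{\mathbb{Z}^d}$ containing no pattern from $\mathcal{F}$ (we say $\mathcal{F}$ induces $X(\mathcal{F})$). A $\mathbb{Z}^d$ shift of finite type (SFT) is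 a subshift of the form $X(\mathcal{F})$ with $\mathcal{F}$ a finite set of finite patterns. The language $L(X)$ is the set of all patterns (finite or infinite) appearing in points of $X$, and $L_S(X)=L(X)\cap\mathcal{A}^S$. Topological entropy: $h(X)=\lim_{n\to\infty}\frac{1}{n^d}\log|L_{C_n}(X)|$. A fixed point of $Y$ is $y\in Y$ with $\sigma_t(y)=y$ for all $t\in\mathbb{Z}^d$. A factor map from a subshift $X$ onto a subshift $Y$ (possibly over different alphabets) is a continuous surjection $\phi:X\to Y$ that commutes with the shift actions: $\phi\circ\sigma_t=\sigma_t\circ\phi$ for all $t\in\mathbb{Z}^d$. A $\mathbb{Z}^d$ subshift $X$ is block gluing if there exists $g\ge 0$ such that for any hyperrectangles $R,R'\subset\mathbb{Z}^d$ with $d(R,R')>g$ and any $w\in L_R(X)$, $w'\in L_{R'}(X)$, there exists $x\in X$ with $x(R)=w$ and $x(R')=w'$ (here $x(R)$ denotes the restriction of $x$ to $R$). For $g\in\mathbb{N}$ (with $0$ allowed), a $\mathbb{Z}^d$ SFT $X$ has the $g$-extension property if there exists a finite set $\mathcal{F}$ of forbidden finite patterns with $X=X(\mathcal{F})$ and the following property: if a pattern $w$ with shape $S$ (finite or infinite) can be extended to a pattern on $S+Q_g$ which does not contain any patterns from $\mathcal{F}$, then $w\in L(X)$, i.e. $w$ can be extended to a point on all of $\mathbb{Z}^d$ containing no patterns from $\mathcal{F}$. $X$ has the finite extension property if it has the $g$-extension property for some $g$. *)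

(* Defs.v *)
From mathcomp Require Import all_boot all_order all_algebra.
From mathcomp Require Import finmap.
From mathcomp Require Import all_classical all_reals all_analysis.

Set Implicit Arguments.
Unset Strict Implicit.
Unset Printing Implicit Defensive.

Import Order.TTheory GRing.Theory Num.Theory.
Local Open Scope classical_set_scope.
Local Open Scope ring_scope.

Definition lattice (d : nat) := {ffun 'I_d -> int}.

Definition dist (d : nat) (v w : lattice d) : nat :=
  (\max_(i < d) absz (v i - w i)%R)%N.

(* For nonempty S and T, this is "the minimum distance from S to T is
   greater than g". *)
Definition dist_gt (d : nat) (g : nat) (S T : set (lattice d)) : Prop :=
  forall s t, S s -> T t -> (g < dist s t)%N.

Definition box (d : nat) (a b : lattice d) : set (lattice d) :=
  [set v | forall i, a i <= v i <= b i].

Definition hyperrectangle (d : nat) (S : set (lattice d)) : Prop :=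
  exists a b : lattice d, (forall i, a i <= b i) /\ S = box a b.

(* C_k = [0, k-1]^d *)
Definition cube (d k : nat) : set (lattice d) :=
  [set v | forall i, 0 <= v i < k%:Z].

(* Q_k = [-k, k]^d *)
Definition ball_cube (d k : nat) : set (lattice d) :=
  [set v | forall i, - k%:Z <= v i <= k%:Z].

(* A pattern is a partial function on the lattice; its shape is its domain. *)
Definition pattern (d : nat) (A : finType) := lattice d -> option A.

Definition shape (d : nat) (A : finType) (w : pattern d A) : set (lattice d) :=
  [set s | w s != None].

Definition restr (d : nat) (A : finType) (S : set (lattice d))
    (w : pattern d A) : pattern d A :=
  fun s => if `[< S s >] then w s else None.

Definition translate (d : nat) (A : finType) (t : lattice d)
    (w : pattern d A) : pattern d A :=
  fun s => w (s - t).

Definition contains (d : nat) (A : finType) (p w : pattern d A) : Prop :=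
  exists S t, restr S p = translate t w.

Definition extends (d : nat) (A : finType) (w' w : pattern d A) : Prop :=
  restr (shape w) w' = w.

Definition avoids (d : nat) (A : finType) (F : set (pattern d A))
    (p : pattern d A) : Prop :=
  forall f, F f -> ~ contains p f.

(* The full shift, with the product of the discrete topologies. *)
Definition config (d : nat) (A : finType) :=
  prod_topology (fun _ : lattice d => discrete_topology A).

Definition full_pattern (d : nat) (A : finType) (x : config d A) :
    pattern d A :=
  fun s => Some (x s).

Definition shift_act (d : nat) (A : finType) (t : lattice d) (x : config d A) :
    config d A :=
  fun s => x (s + t).

Definition subshift (d : nat) (A : finType) (X : set (config d A)) : Prop :=
  closed X /\ forall t x, X x -> X (shift_act t x).

Definition induced (d : nat) (A : finType) (F : set (pattern d A)) :
    set (config d A) :=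
  [set x | avoids F (full_pattern x)].

Definition finite_forbidden (d : nat) (A : finType)
    (F : set (pattern d A)) : Prop :=
  finite_set F /\ forall f, F f -> finite_set (shape f).

Definition sft (d : nat) (A : finType) (X : set (config d A)) : Prop :=
  subshift X /\ exists F, finite_forbidden F /\ X = induced F.

Definition language (d : nat) (A : finType) (X : set (config d A)) :
    set (pattern d A) :=
  [set w | exists2 x, X x & contains (full_pattern x) w].

Definition language_on (d : nat) (A : finType) (S : set (lattice d))
    (X : set (config d A)) : set (pattern d A) :=
  language X `&` [set w | shape w = S].

(* Since lne 0 = -oo, the empty subshift has entropy -oo. *)
Definition entropy (R : realType) (d : nat) (A : finType)
    (X : set (config d A)) : \bar R :=
  limn (fun n : nat =>
    ((n%:R ^+ d)^-1)%:E
      * lne (#|` fset_set (language_on (@cube d n) X)|%:R)%:E)%E.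

Definition fixed_point (d : nat) (A : finType) (Y : set (config d A))
    (y : config d A) : Prop :=
  Y y /\ forall t, shift_act t y = y.

Definition block_gluing (d : nat) (A : finType) (X : set (config d A)) : Prop :=
  subshift X /\
  exists g : nat, forall S T : set (lattice d),
    hyperrectangle S -> hyperrectangle T -> dist_gt g S T ->
    forall w w', language_on S X w -> language_on T X w' ->
    exists x, [/\ X x, restr S (full_pattern x) = w
                & restr T (full_pattern x) = w'].

Definition extension_property (d : nat) (A : finType) (g : nat)
    (X : set (config d A)) : Prop :=
  exists F, [/\ finite_forbidden F, X = induced F &
    forall w w' : pattern d A,
      shape w' = [set s + q | s in shape w & q in @ball_cube d g] ->
      extends w' w -> avoids F w' -> language X w].

Definition finite_extension_property (d : nat) (A : finType)
    (X : set (config d A)) : Prop :=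
  sft X /\ exists g : nat, extension_property g X.

(* The values of phi outside X are irrelevant. *)
Definition factor_map (d : nat) (A B : finType) (X : set (config d A))
    (Y : set (config d B)) (phi : config d A -> config d B) : Prop :=
  [/\ {within X, continuous phi}, phi @` X = Y
    & forall t x, X x -> phi (shift_act t x) = shift_act t (phi x)].

(* Main.v *)
Require Import Defs.
From mathcomp Require Import all_boot all_order all_algebra.
From mathcomp Require Import finmap zify ring lra.
From mathcomp Require Import all_classical all_reals all_analysis.
Import Defs.

(** The factor map reads a point x of X through sparse markers, decodes what
surrounds each marker into a block of Y, and then repairs the resulting
configuration locally so that it lies in Y.

Markers and decoding.  Put n = a (l + g), where g is the gluing distance,
l = 2 i + g is a length and a is a multiple of 4.  Pairwise gluing of boxes,
iterated, shows that blocks of side l can be prescribed independently on all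
cells of the grid (l + g) Z^d ([grid_gluing]).  A marker block P of side l is
placed on every cell of n Z^d, and the other a^d - 1 cells of each period carry
the message.  Comparing entropies, the messages outnumber the blocks of side n
of Y ([scales_exist]), so a decoder exists ([decoder_exists]).  The markers of x
are the occurrences of P at distance at least n from every other occurrence;
hence markers are separated in every point, whatever x is.

What must be arranged is that P has no stray occurrences in the points built for
surjectivity.  A stray occurrence may straddle several cells, but one of its 2^d
corners, a subcube of side i, fits inside a single cell ([corner_cell]).  So it
suffices that each corner of P occurs in P only at its own place and in none of
the message blocks.  A counting argument gives such a P: blocks that are
determined by their restriction to the complement of one corner number at most
N(i)^(2^d - 1) times the number of fillings of the gaps, where N(i) counts the
blocks of side i, whereas N(l) is at least N(i)^(2^d).  The gap volume has order
i^(d-1), so these blocks are exponentially rare, and some P avoids all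
coincidences and is avoided by half of all blocks ([marker_exists]).

Repairing.  The decoded configuration w equals the fixed symbol b0 away from the
markers, so forbidden patterns occur only near markers.  All sites near such an
occurrence are erased, and the erased part is filled in a bounded number of
rounds.  In each round one offset o is chosen and, simultaneously for every
marker v, the pattern on a large cube around v + o is replaced by that of a point
of Y agreeing with the current pattern wherever the latter is defined on the
whole window of radius gY (the extension radius of Y) around a site; such a point
exists by the finite extension property.  A round shrinks the defined region by
gY elsewhere, but the patched cubes have size of order n while the number 13^d of
rounds does not depend on n: for n large every site is defined at the end
([correction_exists]).  If w is already a point of Y nothing changes, which yields
surjectivity.

Entropy is a limit; for the nonempty subshift Y it is shown to converge by the
subadditivity argument of Fekete ([rate_cvg]), so that the strict inequality
between limits becomes an inequality between block counts ([entropy_gap]). *)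

Set Implicit Arguments.
Unset Strict Implicit.
Unset Printing Implicit Defensive.

Import Order.TTheory GRing.Theory Num.Theory.
Import numFieldNormedType.Exports.
Local Open Scope classical_set_scope.
Local Open Scope ring_scope.

(** * Windows of the lattice and sliding block codes *)

Section Lattice.
Variable d : nat.
Implicit Types (s t u : lattice d) (r n : nat).

Lemma latD s t i : (s + t) i = s i + t i. Proof. by rewrite ffunE. Qed.
Lemma latN s i : (- s) i = - s i. Proof. by rewrite ffunE. Qed.
Lemma lat0 i : (0 : lattice d) i = 0. Proof. by rewrite ffunE. Qed.
Lemma latP s t : (forall i, s i = t i :> int) -> s = t.
Proof. by move=> h; apply/ffunP. Qed.
Definition latE := (latD, latN, lat0).

Definition inQ r s := forall i, (absz (s i) <= r)%N.

Lemma ball_cubeE r s : ball_cube r s = inQ r s.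
Proof. rewrite /ball_cube /= /inQ; apply/propext; split=> h i; move: (h i); lia. Qed.

Lemma inQ0 r : inQ r 0.
Proof. by move=> i; rewrite ffunE. Qed.

Lemma inQS r1 r2 s : (r1 <= r2)%N -> inQ r1 s -> inQ r2 s.
Proof. by move=> le h i; apply: leq_trans le. Qed.

Lemma inQN r s : inQ r s -> inQ r (- s).
Proof. by move=> h i; move: (h i); rewrite latE; lia. Qed.

Lemma inQD r1 r2 s t : inQ r1 s -> inQ r2 t -> inQ (r1 + r2) (s + t).
Proof. by move=> h k i; move: (h i) (k i); rewrite latE; lia. Qed.

Lemma inQB r1 r2 s t : inQ r1 s -> inQ r2 t -> inQ (r1 + r2) (s - t).
Proof. by move=> h /inQN; apply: inQD. Qed.

Lemma inQ_ex s : exists r, inQ r s.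
Proof.
exists (\sum_i absz (s i))%N => i.
by rewrite (bigD1 i) //= leq_addr.
Qed.

Lemma finite_inQ (S : set (lattice d)) :
  finite_set S -> exists r, forall s, S s -> inQ r s.
Proof.
move=> /finite_seqP[c ->]; elim: c => [|x c [r hr]]; first by exists 0%N.
have [k hk] := inQ_ex x.
exists (maxn k r) => s /=; rewrite inE => /orP[/eqP->|sc].
  by apply: inQS hk; rewrite leq_maxl.
by apply: inQS (hr _ sc); rewrite leq_maxr.
Qed.

Lemma inQ_finite r : finite_set (inQ r : set (lattice d)).
Proof.
pose f (c : {ffun 'I_d -> 'I_(r + r).+1}) : lattice d :=
  [ffun i => (c i : nat)%:Z - r%:Z].
apply: (@sub_finite_set _ _ (f @` setT)); last first.
  by apply: finite_image; exact: finite_finset.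
move=> s hs.
exists [ffun i => inord (absz (s i + r%:Z))] => //.
apply/ffunP=> i; rewrite !ffunE.
have h := hs i.
have lt : (absz (s i + r%:Z)%R < (r + r).+1)%N by move: h; clear; lia.
have E : (absz (s i + r%:Z))%:Z - r%:Z = s i by move: h; clear; lia.
by rewrite inordK.
Qed.

End Lattice.

Ltac latlia := apply: latP => ?; rewrite !latE; lia.

Section SBC.
Variable d : nat.

(** Sliding block codes: locality and shift-equivariance are one condition, because
the two windows that are compared may sit at different sites of different
configurations.  The alphabets are arbitrary types, so marker sets (with values
in Prop) and partial configurations are covered. *)
Definition sbc (A C : Type) (Phi : (lattice d -> A) -> lattice d -> C) :=
  exists r, forall x x' s s', (forall u, inQ r u -> x (s + u) = x' (s' + u)) ->
    Phi x s = Phi x' s'.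

Lemma sbc_shift (A B : finType) (Phi : (lattice d -> A) -> lattice d -> B) t x :
  sbc Phi -> Phi (shift_act t x) = shift_act t (Phi x).
Proof.
move=> [r hr]; apply/funext=> s; apply: hr => u _.
by rewrite /shift_act addrAC.
Qed.

Lemma site_nbhs (A : finType) (x : config d A) s :
  nbhs x [set x' : config d A | x' s = x s].
Proof.
apply: (@proj_continuous _ (fun _ : lattice d => discrete_topology A) s x
  [set a | a = x s]).
by apply: open_nbhs_nbhs; split; first exact: discrete_open.
Qed.

Lemma cylinder_nbhs (A : finType) (x : config d A) r :
  nbhs x [set x' : config d A | forall u, inQ r u -> x' u = x u].
Proof.
have : nbhs x (\bigcap_(u in [set` fset_set (inQ r : set (lattice d))])
    [set x' : config d A | x' u = x u]).
  by apply: filter_bigI => u _; exact: site_nbhs.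
apply: filterS => x' hx' u hu; apply: hx'.
by rewrite /= in_fset_set ?inE //; exact: inQ_finite.
Qed.

(** The analogue for maps into a product of the fact that a topology generated by
coordinates only needs to be tested on coordinates. *)
Lemma continuous_to_prod (T : topologicalType) (I : Type)
    (K : I -> topologicalType) (f : T -> prod_topology K) :
  (forall i, continuous (fun x => f x i)) -> continuous f.
Proof.
move=> h x; apply/cvg_sup => i U [P [[Q oQ <-] Qx] PU].
by apply: (filterS PU); apply: (h i x); exact: open_nbhs_nbhs.
Qed.

Lemma sbc_continuous (A B : finType) (Phi : config d A -> config d B) :
  sbc Phi -> continuous Phi.
Proof.
move=> [r hr].
apply: (@continuous_to_prod _ _ (fun _ : lattice d => discrete_topology B)).
move=> s x U /nbhs_singleton Ux.
have [k hk] := inQ_ex s.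
apply: filterS (cylinder_nbhs x (k + r)) => x' hx' /=.
have -> : Phi x' s = Phi x s; last by [].
by apply: hr => u hu; apply: hx'; apply: inQD.
Qed.
End SBC.

(** * Repairing configurations *)

Section Correction.
Variables (d : nat) (B : finType) (Y : set (config d B)).
Variables (F : set (pattern d B)) (g D : nat) (b0 : B).
Implicit Types (s t u v o r : lattice d) (p q : pattern d B) (y : config d B).
Implicit Type (M : lattice d -> Prop).

(** With patterns taken up to translation, containment is an occurrence at some t. *)
Definition occurs (f : pattern d B) t p :=
  forall s b, f s = Some b -> p (s + t) = Some b.

Lemma containsE p (f : pattern d B) : contains p f <-> exists t, occurs f t p.
Proof.
split=> [[S [t E]]|[t occ]].
  exists t => s b fs; have := congr1 (fun h => h (s + t)) E.
  by rewrite /translate /restr addrK fs; case: asboolP.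
exists [set s | f (s - t) != None], t; apply/funext => s.
rewrite /translate /restr; case: asboolP => /=.
  by case E : (f (s - t)) => [b|] // _; rewrite -(occ _ _ E) subrK.
by move/negP; rewrite negbK => /eqP ->.
Qed.

Definition admissible p := forall f t, F f -> ~ occurs f t p.

Lemma admissibleE p : avoids F p <-> admissible p.
Proof.
split=> [h f t Ff occ|h f Ff /containsE[t]]; last exact: h.
by apply: (h f Ff); apply/containsE; exists t.
Qed.

Hypothesis Yind : Y = induced F.
Hypothesis FD : forall f s, F f -> f s <> None -> inQ D s.
Hypothesis Yb0 : Y (fun=> b0).
Hypothesis Yext : forall w w' : pattern d B,
      shape w' = [set s + q | s in shape w & q in @ball_cube d g] ->
      extends w' w -> avoids F w' -> language Y w.
Hypothesis Yshift : forall t y, Y y -> Y (shift_act t y).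

Lemma YE y : Y y <-> admissible (full_pattern y).
Proof. by rewrite Yind -admissibleE. Qed.

Lemma forbidden_nonempty f : F f -> exists s, f s <> None.
Proof.
move=> Ff; apply: contrapT => /forallNP h.
have /YE/(_ f 0 Ff) H := Yb0; apply: H => s b E.
by case: (h s); rewrite E.
Qed.

(** The conclusion that the finite extension property yields for an admissible p. *)
Definition interior_extends p y :=
  forall s, (forall u, inQ g u -> p (s + u) <> None) -> p s = Some (y s).

(** The finite extension property, applied to the restriction of p to the sites
whose window lies in its domain: p itself is the required locally admissible
extension by Q_g. *)
Lemma interior_extension p :
  admissible p -> exists2 y, Y y & interior_extends p y.
Proof.
move=> adm.
pose E := [set s | forall u, inQ g u -> p (s + u) <> None].
have Ep s : E s -> p s <> None by move=> /(_ 0 (@inQ0 _ _)); rewrite addr0.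
pose w := restr E p.
have shw : shape w = E.
  apply/seteqP; split=> s; rewrite /shape /w /restr /=; case: asboolP => //.
  by move=> /Ep /eqP.
pose E' := [set s + q | s in shape w & q in @ball_cube d g].
pose w' := restr E' p.
have shw' : shape w' = E'.
  apply/seteqP; split=> s; rewrite {1}/shape /w' /restr /=; case: asboolP => //.
  by move=> [s1]; rewrite shw => Es [u]; rewrite ball_cubeE => hu <- _; apply/eqP/Es.
have /(Yext shw') : extends w' w.
  rewrite /extends shw /w /w' /restr; apply/funext=> s.
  case: asboolP => // Es; case: asboolP => // -[].
  by exists s; [rewrite shw|exists 0; rewrite ?ball_cubeE ?addr0 //; exact: inQ0].
case.
  apply/admissibleE => f t Ff occ; apply: (adm f t Ff) => s b /occ.
  by rewrite /w' /restr; case: asboolP.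
move=> x Yx [S [t ES]]; exists (shift_act t x); first exact: Yshift.
move=> s Es; have := congr1 (fun h => h (s + t)) ES.
rewrite /translate /restr addrK /w /restr (asboolT Es) /shift_act.
by case: asboolP => // _ H; case: (Ep s Es).
Qed.

(** Choosing one completion for each pattern, centred at the origin, is what makes
the repair shift-equivariant. *)
Definition completion p : config d B :=
  xget (fun=> b0) [set y | Y y /\ interior_extends p y].

Lemma completionP p : admissible p -> Y (completion p) /\ interior_extends p (completion p).
Proof.
move=> /interior_extension[y Yy iy]; rewrite /completion.
by case: xgetP => [z _ //|/(_ y)]; case.
Qed.

Definition window p (R : nat) (c : lattice d) : pattern d B :=
  fun u => if `[< inQ R u >] then p (c + u) else None.

Lemma admissible_window p R c : admissible p -> admissible (window p R c).
Proof.
move=> adm f t Ff occ; apply: (adm f (c + t) Ff) => s b /occ.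
by rewrite /window addrCA; case: asboolP.
Qed.

Section Repair.
Variables (R1 R : nat).

(** The possible positions of s relative to a patch centre v + o, v in M.  For a
separated M there is at most one; for any M the set depends only on the view
from s, so choosing an element of it is equivariant. *)
Definition displacements M o s := [set r | inQ R1 r /\ M (s - r - o)].

(** The sites that survive outside the patches are exactly those at which a nearby
completion is known to agree with p; this is what prevents forbidden patterns
across the border of a patch. *)
Definition repair_step M o p : pattern d B := fun s =>
  if `[< displacements M o s !=set0 >] then
    let r := xget 0 (displacements M o s) in Some (completion (window p R (s - r)) r)
  else if `[< forall u, inQ g u -> p (s + u) <> None >] then p s else None.

Lemma repair_step_dom M o p s :
  (forall u, inQ g u -> p (s + u) <> None) -> repair_step M o p s <> None.
Proof.
move=> h; rewrite /repair_step; case: ifP => // _; rewrite asboolT //.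
by have := h 0 (@inQ0 _ _); rewrite addr0.
Qed.

Lemma repair_step_cover M o p s v : M v -> inQ R1 (s - v - o) ->
  repair_step M o p s <> None.
Proof.
move=> Mv h; rewrite /repair_step asboolT //; exists (s - v - o); split=> //.
by have -> : s - (s - v - o) - o = v by latlia.
Qed.

Lemma repair_step_off M o p s : ~ (displacements M o s !=set0) ->
  repair_step M o p s = if `[< forall u, inQ g u -> p (s + u) <> None >] then p s else None.
Proof. by move=> h; rewrite /repair_step asboolF. Qed.

Lemma repair_step_sbc A (M : (lattice d -> A) -> lattice d -> Prop)
    (p : (lattice d -> A) -> pattern d B) o :
  sbc M -> sbc p -> sbc (fun x => repair_step (M x) o (p x)).
Proof.
move=> [rM hM] [rp hp]; have [k hk] := inQ_ex o.
exists (rM + R1 + k + rp + R1 + R + g)%N => x x' s s' hx.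
have C : displacements (M x) o s = displacements (M x') o s'.
  apply/seteqP; rewrite /displacements; split=> r /= [r1]; move=> Mr; split=> //; move: Mr.
    rewrite (hM x x' _ (s' - r - o)) // => u hu.
    by rewrite -!addrA; apply: hx; apply: inQS (inQD (inQN r1) (inQD (inQN hk) hu)); lia.
  rewrite (hM x x' _ (s' - r - o)) // => u hu.
  by rewrite -!addrA; apply: hx; apply: inQS (inQD (inQN r1) (inQD (inQN hk) hu)); lia.
rewrite /repair_step C; case: asboolP => [ne|_].
  have r1 : inQ R1 (xget 0 (displacements (M x') o s')).
    by case: xgetP => [? _ []|] //; case: ne => r h /(_ r).
  set r := xget _ _ in r1 *; congr (Some (completion _ _)); apply/funext => u.
  rewrite /window; case: asboolP => // hu; apply: hp => w hw.
  by rewrite -!addrA; apply: hx; apply: inQS (inQD (inQN r1) (inQD hu hw)); lia.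
have pE u : inQ g u -> p x (s + u) = p x' (s' + u).
  move=> hu; apply: hp => w hw.
  by rewrite -!addrA; apply: hx; apply: inQS (inQD hu hw); lia.
have -> : (forall u, inQ g u -> p x (s + u) <> None) =
          (forall u, inQ g u -> p x' (s' + u) <> None).
  by apply/propext; split=> h u hu; have := h u hu; rewrite pE.
by have := pE 0 (@inQ0 _ _); rewrite !addr0 => ->.
Qed.

Definition repair M (l : seq (lattice d)) p := foldl (fun p o => repair_step M o p) p l.

(** Each round erodes the domain by at most g. *)
Lemma repair_dom M l p s :
  (forall u, inQ (g * size l) u -> p (s + u) <> None) -> repair M l p s <> None.
Proof.
elim: l p s => [|o l IH] p s /= h; first by have := h 0 (@inQ0 _ _); rewrite addr0.
apply: IH => u hu; apply: repair_step_dom => v hv.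
by rewrite -addrA; apply: h; apply: inQS (inQD hu hv); rewrite mulnS addnC.
Qed.

(** A patch of radius R1 is eroded by g in each later round, so its core of radius T
survives to the end. *)
Lemma repair_cover M l p s v o T :
  M v -> o \in l -> inQ T (s - v - o) -> (T + g * size l <= R1)%N ->
  repair M l p s <> None.
Proof.
move=> Mv; elim: l p => [|o' l IH] p //=.
rewrite inE mulnS => /orP[/eqP<-|ol] h le; last first.
  by apply: IH => //; apply: leq_trans le; rewrite leq_add2l leq_addl.
apply: repair_dom => u hu; apply: repair_step_cover Mv _.
have -> : s + u - v - o = s - v - o + u by latlia.
by apply: inQS (inQD h hu); apply: leq_trans le; rewrite leq_add2l leq_addl.
Qed.

Lemma repair_sbc A (M : (lattice d -> A) -> lattice d -> Prop)
    (p : (lattice d -> A) -> pattern d B) l :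
  sbc M -> sbc p -> sbc (fun x => repair (M x) l (p x)).
Proof.
by move=> hM; elim: l p => //= o l IH p hp; apply: IH; apply: repair_step_sbc.
Qed.

Hypothesis window_wide : (R1 + D + D + g <= R)%N.

Lemma repair_step_eq M o p s r :
  (forall v v', M v -> M v' -> inQ (R1 + R1 + D + D) (v - v') -> v = v') ->
  displacements M o s r -> repair_step M o p s = Some (completion (window p R (s - r)) r).
Proof.
move=> sep Cr; rewrite /repair_step asboolT; last by exists r.
case: xgetP => [r' _ [r'1 r'2]|/(_ r)]; last by case.
case: Cr => r1 r2.
have : s - r' - o = s - r - o.
  apply: sep => //; have -> : s - r' - o - (s - r - o) = r - r'.
    by latlia.
  by apply: inQS (inQB r1 r'1); rewrite -addnA leq_addr.
by move=> /addIr/addrI/oppr_inj ->.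
Qed.

(** An occurrence of a forbidden pattern has diameter at most 2 D.  If it comes close
to a patch centre, it lies where the new pattern agrees with the completion, a
point of Y: inside the patch by definition, outside it because only sites at
which the completion agrees with p were retained.  Otherwise it misses all
patches and occurs in p. *)
Lemma repair_step_admissible M o p :
  (forall v v', M v -> M v' -> inQ (R1 + R1 + D + D) (v - v') -> v = v') ->
  admissible p -> admissible (repair_step M o p).
Proof.
move=> sep adm f t Ff occ.
have [[v [Mv vt]]|far] :=
    pselect (exists v, M v /\ inQ (R1 + D) (t - (v + o))); last first.
  apply: (adm f t Ff) => s b fs; move: (occ _ _ fs).
  rewrite repair_step_off; first by case: asboolP.
  case=> r [r1 Mr]; apply: far; exists (s + t - r - o); split=> //.
  have -> : t - (s + t - r - o + o) = r - s by latlia.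
  by apply: inQB => //; apply: FD Ff _; rewrite fs.
have [Yy iy] := completionP (@admissible_window p R (v + o) adm).
set y := completion _ in Yy iy.
move/YE: Yy => /(_ f (t - (v + o)) Ff); apply=> s b fs; rewrite /full_pattern.
congr Some; rewrite addrA; set z := s + t in occ *.
have Dz : inQ (R1 + D + D) (z - (v + o)).
  rewrite /z -addrA addrC; apply: inQD => //.
  by apply: FD Ff _; rewrite fs.
have := occ _ _ fs; rewrite -/z.
have [[r Cr]|noC] := pselect (displacements M o z !=set0); last first.
  rewrite repair_step_off //; case: asboolP => // full pz.
  have W u : inQ g u -> window p R (v + o) (z - (v + o) + u) = p (z + u).
    move=> hu; rewrite /window asboolT; last first.
      by apply: inQS window_wide _; apply: inQD.
    by rewrite addrA addrCA subrr addr0.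
  have := iy (z - (v + o)).
  have := W 0 (@inQ0 _ _); rewrite !addr0 => ->; rewrite pz => H.
  suff: Some b = Some (y (z - (v + o))) by case.
  by apply: H => u hu; rewrite W //; exact: full.
rewrite (repair_step_eq _ sep Cr) => -[<-].
case: Cr => r1 r2.
have E : z - r - o = v.
  apply: sep => //.
  have -> : z - r - o - v = z - (v + o) - r.
    by latlia.
  by apply: inQS (inQB Dz r1); lia.
have Evo : v + o = z - r by rewrite -E subrK.
by rewrite /y Evo subKr.
Qed.

Lemma repair_step_id M o y :
  (forall v v', M v -> M v' -> inQ (R1 + R1 + D + D) (v - v') -> v = v') ->
  Y y -> repair_step M o (full_pattern y) = full_pattern y.
Proof.
move=> sep Yy; apply/funext => s.
have [[r Cr]|noC] := pselect (displacements M o s !=set0); last first.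
  by rewrite repair_step_off // asboolT.
rewrite (repair_step_eq _ sep Cr); case: Cr => r1 _.
have adm : admissible (window (full_pattern y) R (s - r)).
  by apply: admissible_window; apply/YE.
have [_ /(_ r)] := completionP adm.
have W u : inQ g u -> window (full_pattern y) R (s - r) (r + u) = Some (y (s + u)).
  move=> hu; rewrite /window asboolT ?addrA ?subrK //.
  by apply: inQS (inQD r1 hu); lia.
have := W 0 (@inQ0 _ _); rewrite !addr0 => -> H; rewrite -H //.
by move=> u hu; rewrite W.
Qed.

Lemma repair_admissible M l p :
  (forall v v', M v -> M v' -> inQ (R1 + R1 + D + D) (v - v') -> v = v') ->
  admissible p -> admissible (repair M l p).
Proof.
by move=> sep; elim: l p => //= o l IH p adm; apply: IH; apply: repair_step_admissible.
Qed.

Lemma repair_id M l y :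
  (forall v v', M v -> M v' -> inQ (R1 + R1 + D + D) (v - v') -> v = v') ->
  Y y -> repair M l (full_pattern y) = full_pattern y.
Proof. by move=> sep Yy; elim: l => //= o l IH; rewrite repair_step_id. Qed.

End Repair.

(** Erasing neighbourhoods of the base points of the occurrences is uniform in the
forbidden pattern and still removes at least one site of each occurrence. *)
Definition erased (w : lattice d -> B) : pattern d B := fun s =>
  if `[< forall u f, inQ D u -> F f -> ~ occurs f (s + u) (full_pattern w) >]
  then Some (w s) else None.

Lemma erased_admissible w : admissible (erased w).
Proof.
move=> f t Ff occ; have [s fs] := forbidden_nonempty Ff.
case E : (f s) fs => [b|] // _.
have Ds : inQ D s by apply: FD Ff _; rewrite E.
have := occ _ _ E; rewrite /erased; case: asboolP => // /(_ (- s) f (inQN Ds) Ff).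
rewrite addrAC subrr add0r => nocc _; apply: nocc => s' b' fs'.
by have := occ _ _ fs'; rewrite /erased; case: asboolP.
Qed.

Lemma erased_id y : Y y -> erased y = full_pattern y.
Proof.
move=> Yy; apply/funext => s; rewrite /erased asboolT // => u f _ Ff.
by move/YE : Yy; apply.
Qed.

Lemma erased_dom w s :
  (forall u, inQ (D + D) u -> w (s + u) = b0) -> erased w s <> None.
Proof.
move=> h; rewrite /erased asboolT // => u f Du Ff occ.
have /YE/(_ f (s + u) Ff) := Yb0; apply=> s' b fs'; rewrite -(occ _ _ fs').
rewrite /full_pattern addrCA h // addrC; apply: inQD => //.
by apply: FD Ff _; rewrite fs'.
Qed.

Lemma erased_sbc A (w : (lattice d -> A) -> lattice d -> B) :
  sbc w -> sbc (fun x => erased (w x)).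
Proof.
move=> [r hr]; exists (r + D + D)%N => x x' s s' hx.
have W u : inQ (D + D) u -> w x (s + u) = w x' (s' + u).
  move=> hu; apply: hr => v hv; rewrite -!addrA; apply: hx.
  by apply: inQS (inQD hu hv); lia.
have E u f : inQ D u -> F f -> occurs f (s + u) (full_pattern (w x)) =
    occurs f (s' + u) (full_pattern (w x')).
  move=> Du Ff; rewrite /occurs /full_pattern; apply/propext; split=> h t b ft.
    rewrite addrCA -W; first by rewrite addrCA; apply: h.
    by rewrite addrC; apply: inQD => //; apply: FD Ff _; rewrite ft.
  rewrite addrCA W; first by rewrite addrCA; apply: h.
  by rewrite addrC; apply: inQD => //; apply: FD Ff _; rewrite ft.
rewrite /erased; have := W 0 (@inQ0 _ _); rewrite !addr0 => ->.
congr (if `[< _ >] then _ else _).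
by apply/propext; split=> h u f Du Ff; have := h u f Du Ff; rewrite E.
Qed.

(** Offsets on a grid of mesh T, whose number does not depend on T. *)
Definition offsets (T : nat) : seq (lattice d) :=
  [seq [ffun i => (T%:Z * ((c i : nat)%:Z - 6))]
    | c : {ffun 'I_d -> 'I_13} <- enum {ffun 'I_d -> 'I_13}].

Lemma size_offsets T : size (offsets T) = (13 ^ d)%N.
Proof. by rewrite size_map -cardE card_ffun !card_ord. Qed.

Lemma offsets_cover T s : (0 < T)%N -> inQ (6 * T) s ->
  exists2 o, o \in offsets T & inQ T (s - o).
Proof.
move=> T0 hs.
pose c : {ffun 'I_d -> 'I_13} := [ffun i => inord (absz (divz (s i) T + 6)%R)].
have cE i : exists m : int, [/\ s i = T%:Z * ((c i : nat)%:Z - 6) + m, 0 <= m & m < T%:Z].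
  exists (modz (s i) T); rewrite ffunE inordK.
    have := divz_eq (s i) T; have := modz_ge0 (s i) (_ : T%:Z != 0).
    have := ltz_pmod (s i) (_ : 0 < T%:Z).
    have := hs i; set q := divz _ _; set m := modz _ _ => h1 h2 h3 h4.
    have q6 : (-6 <= q) by nia.
    split=> //; [|apply: h3; lia|apply: h2; lia].
    by rewrite {1}h4; nia.
  have := divz_eq (s i) T; have := modz_ge0 (s i) (_ : T%:Z != 0).
  have := ltz_pmod (s i) (_ : 0 < T%:Z).
  have := hs i; set q := divz _ _; set m := modz _ _ => h1 h2 h3 h4.
  have {}h2 := h2 _; have {}h3 := h3 _.
  nia.
exists [ffun i => (T%:Z * ((c i : nat)%:Z - 6))].
  apply/mapP; exists c => //; by rewrite mem_enum.
move=> i; rewrite latD latN [X in - X]ffunE.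
by have [m [-> m0 mT]] := cE i; rewrite addrAC subrr add0r; lia.
Qed.

(** The scale T is tied to the separation 4 T of the markers.  Patches have radius
T + g 13^d, which is less than half the separation once T is large, so patches
of one round stay apart.  Since w is b0 at distance more than 4 T from the markers, the
sites to be filled lie within 6 T of a marker, where the 13^d offsets suffice. *)
Lemma correction_exists A : exists T0 : nat, forall T, (T0 <= T)%N ->
  exists C : (lattice d -> Prop) -> (lattice d -> B) -> (lattice d -> B),
  [/\ forall (M : (lattice d -> A) -> lattice d -> Prop) w,
        sbc M -> sbc w -> sbc (fun x => C (M x) (w x)),
    forall M w,
      (forall v v', M v -> M v' -> inQ (4 * T).-1 (v - v') -> v = v') ->
      (forall s, w s <> b0 -> exists2 v, M v & inQ (4 * T) (s - v)) ->
      Y (C M w)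
    & forall M y,
      (forall v v', M v -> M v' -> inQ (4 * T).-1 (v - v') -> v = v') ->
      Y y -> C M y = y].
Proof.
set N := (13 ^ d)%N.
(* 2 R1 + 2 D < 4 T keeps patches apart, and 4 T + 2 D + g N <= 6 T bounds the
   region to be filled *)
exists (g * N + D + D + 1)%N => T hT.
pose R1 := (T + g * N)%N.
pose C M w s := odflt b0 (repair R1 (R1 + D + D + g) M (offsets T) (erased w) s).
have sepR M : (forall v v', M v -> M v' -> inQ (4 * T).-1 (v - v') -> v = v') ->
    forall v v', M v -> M v' -> inQ (R1 + R1 + D + D) (v - v') -> v = v'.
  move=> sep v v' Mv Mv' h; apply: sep => //; apply: inQS h.
  by rewrite /R1; lia.
exists C; split.
- move=> M w hM hw.
  have [r hr] := repair_sbc R1 (R1 + D + D + g) (offsets T) hM (erased_sbc hw).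
  by exists r => x x' s s' /hr; rewrite /C => ->.
- move=> M w sep near; apply/YE.
  have -> : full_pattern (C M w) =
      repair R1 (R1 + D + D + g) M (offsets T) (erased w); last first.
    by apply: repair_admissible; [|exact: sepR|exact: erased_admissible].
  apply/funext => s; rewrite /full_pattern /C.
  case E : (repair _ _ _ _ _ s) => [//|]; exfalso; move: E.
  have [[v [Mv hv]]|far] := pselect (exists v, M v /\ inQ (6 * T) (s - v)).
    have [|o oT ho] := offsets_cover _ hv; first lia.
    by apply: repair_cover Mv oT ho _; rewrite ?size_offsets.
  apply: repair_dom => u; rewrite size_offsets => hu; apply: erased_dom => u' hu'.
  apply: contrapT => /near [v Mv hv]; apply: far; exists v; split=> //.
  have -> : s - v = s + u + u' - v - u - u' by latlia.
  by apply: inQS (inQB (inQB hv hu) hu'); rewrite -/N; lia.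
- move=> M y sep Yy; apply/funext => s; rewrite /C erased_id // repair_id //.
  exact: sepR.
Qed.

End Correction.

(** * Gluing blocks along a grid *)

Lemma latMn d (s : lattice d) n i : (s *+ n) i = n%:Z * s i.
Proof. by elim: n => [|n IH]; rewrite ?mulr0n ?lat0 ?mul0r // mulrS latD IH; lia. Qed.

Section Gluing.
Variables (d : nat) (A : finType) (X : set (config d A)).
Hypothesis Xclosed : closed X.
Hypothesis Xshift : forall t x, X x -> X (shift_act t x).
Implicit Types (s t u v : lattice d) (x : config d A).

(** A cluster point of points that meet the condition on larger and larger cubes meets
it everywhere, because each site is determined by a neighbourhood. *)
Lemma compactness (K : lattice d -> A -> Prop) :
  (forall m, exists2 x, X x & forall z, inQ m z -> K z (x z)) ->
  exists2 x, X x & forall z, K z (x z).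
Proof.
move=> /(_ _)/cid2-/all_sig2[x Xx Kx].
have cX : compact X.
  apply: (@subclosed_compact _ _ [set f : config d A | forall z, setT (f z)]) => //.
  apply: (@tychonoff _ (fun=> discrete_topology A) (fun=> setT)) => _.
  apply: finite_compact; exact: finite_finset.
have FX : (x @ \oo) X by exists 0%N => // n _; exact: Xx.
have [y [Xy cy]] := cX _ _ FX.
exists y => // z; have [k hk] := inQ_ex z.
have Ek : (x @ \oo) (x @` [set n | (k <= n)%N]).
  by exists k => // n /= kn; exists n.
(* a cluster point agrees at z with points arbitrarily late in the sequence *)
have [_ [[n kn <-] <-]] := cy _ _ Ek (site_nbhs y z).
by apply: Kx; apply: inQS hk.
Qed.

Variable g : nat.
Hypothesis Xglue : forall S T : set (lattice d),
    hyperrectangle S -> hyperrectangle T -> dist_gt g S T ->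
    forall w w', language_on S X w -> language_on T X w' ->
    exists x, [/\ X x, restr S (full_pattern x) = w
                & restr T (full_pattern x) = w'].

Lemma glue_points S T x1 x2 :
  hyperrectangle S -> hyperrectangle T -> dist_gt g S T -> X x1 -> X x2 ->
  exists x, [/\ X x, forall s, S s -> x s = x1 s & forall s, T s -> x s = x2 s].
Proof.
have Lr x V : X x -> language_on V X (restr V (full_pattern x)).
  move=> Xx; split.
    exists x => //; exists V, 0; apply/funext => s.
    by rewrite /translate subr0.
  by apply/seteqP; split=> s; rewrite /shape /restr /=; case: asboolP.
have Er x x' V : restr V (full_pattern x) = restr V (full_pattern x') ->
    forall s, V s -> x s = x' s.
  move=> E s Vs; have := congr1 (fun h => h s) E.
  by rewrite /restr asboolT // => -[].
move=> hS hT dST X1 X2.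
have [x [Xx /Er E1 /Er E2]] := Xglue hS hT dST (Lr _ S X1) (Lr _ T X2).
by exists x.
Qed.

Lemma dist_gt_coord S T k : (forall s t, S s -> T t -> (g < absz (s k - t k)%R)%N) ->
  @dist_gt d g S T.
Proof.
move=> h s t Ss Tt; apply: leq_trans (h s t Ss Tt) _.
exact: (leq_bigmax (F := fun i => absz (s i - t i)%R)).
Qed.

Variable l : nat.
Hypothesis l0 : (0 < l)%N.
Variable u : lattice d -> config d A.
Hypothesis Xu : forall v, X (u v).

Let prescribed x v := forall s, cube l s -> x (v *+ (l + g) + s) = u v s.

(** Gluing is available for two boxes only.  A box of cells is cut into two shorter
ones, each realized inside its convex hull, and the two hulls are glued; the
values on the gaps inside a hull are whatever the realizing point has there. *)
Lemma box_gluing (a b : lattice d) : (forall i, a i <= b i) ->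
  exists2 x, X x & forall v, box a b v -> prescribed x v.
Proof.
have [m] := ubnP (\sum_i absz (b i - a i)); elim: m a b => // m IH a b hm ab.
have [[k kab]|/forallNP eqab] := pselect (exists k, a k < b k); last first.
  exists (shift_act (- (a *+ (l + g))) (u a)); first exact: Xshift.
  move=> v abv s ls; have -> : v = a.
    apply: latP => i; move: (abv i) (eqab i) (ab i); lia.
  by rewrite /shift_act addrAC subrr add0r.
pose b' : lattice d := [ffun i => if i == k then a k else b i].
pose a' : lattice d := [ffun i => if i == k then a k + 1 else a i].
have b'E i : b' i = (if i == k then a k else b i) by rewrite ffunE.
have a'E i : a' i = (if i == k then a k + 1 else a i) by rewrite ffunE.
have sumE (f : 'I_d -> nat) : (\sum_i f i = f k + \sum_(i | i != k) f i)%N.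
  by rewrite (bigD1 k).
have ab' i : a i <= b' i by rewrite b'E; case: eqP => // ->.
have a'b i : a' i <= b i by rewrite a'E; case: eqP => // ->; lia.
move: hm; rewrite sumE ltnS => hm.
have [|x1 X1 h1] := IH a b' _ ab'.
  apply: leq_trans hm; rewrite sumE b'E eqxx -addSn.
  rewrite (eq_bigr (fun i => absz (b i - a i))); last first.
    by move=> i /negbTE ik; rewrite b'E ik.
  by rewrite leq_add2r; lia.
have [|x2 X2 h2] := IH a' b _ a'b.
  apply: leq_trans hm; rewrite sumE a'E eqxx -addSn.
  rewrite (eq_bigr (fun i => absz (b i - a i))); last first.
    by move=> i /negbTE ik; rewrite a'E ik.
  by rewrite leq_add2r; lia.
pose hull (a b : lattice d) : set (lattice d) :=
  box (a *+ (l + g)) (b *+ (l + g) + [ffun=> (l%:Z - 1)]).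
have hullE a0 b0 s : hull a0 b0 s =
    forall i, (l + g)%:Z * a0 i <= s i <= (l + g)%:Z * b0 i + (l%:Z - 1).
  rewrite /hull /box /=; apply/propext; split=> h i; have := h i.
    by rewrite latD !latMn ffunE.
  by rewrite latD !latMn ffunE.
have hullP (a0 b0 : lattice d) : (forall i, a0 i <= b0 i) -> hyperrectangle (hull a0 b0).
  move=> h; eexists; eexists; split; last by reflexivity.
  by move=> i; rewrite latD !latMn ffunE; move: (h i); nia.
have hull_cell (a0 b0 v s : lattice d) :
    box a0 b0 v -> cube l s -> hull a0 b0 (v *+ (l + g) + s).
  move=> bv ls; rewrite hullE => i; rewrite latD latMn.
  by move: (bv i) (ls i); nia.
have [|x [Xx E1 E2]] := glue_points (hullP _ _ ab') (hullP _ _ a'b) _ X1 X2.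
  apply: (@dist_gt_coord _ _ k) => s t; rewrite !hullE => /(_ k) + /(_ k).
  by rewrite b'E a'E eqxx; nia.
exists x => // v bv s ls.
have [vk|vk] := boolP (v k == a k).
  rewrite E1; last by apply: hull_cell => // i; rewrite b'E;
      case: eqP => [->|_]; move: (bv i) => //=; move/eqP: vk; lia.
  by apply: h1 => // i; rewrite b'E; case: eqP => [->|_]; move: (bv i); move/eqP: vk; lia.
have bv' : box a' b v.
  move=> i; rewrite a'E; case: eqP => [->|_]; last exact: bv.
  by move: (bv k) vk; lia.
by rewrite E2; [apply: h2|apply: hull_cell].
Qed.

Lemma grid_gluing : exists2 x, X x & forall v, prescribed x v.
Proof.
pose K z a := forall v s, cube l s -> z = v *+ (l + g) + s -> a = u v s.
suff [x Xx Kx] : exists2 x, X x & forall z, K z (x z).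
  by exists x => // v s ls; apply: Kx ls _.
apply: compactness => m.
have [|x Xx hx] := @box_gluing [ffun=> - (m%:Z + 1)] [ffun=> m%:Z + 1].
  by move=> i; rewrite !ffunE; lia.
exists x => // z hz v s ls E; rewrite E; apply: hx => // i.
rewrite [X in X <= _]ffunE [X in _ && (_ <= X)]ffunE.
have := hz i; rewrite E latD latMn; move: (ls i); nia.
Qed.
End Gluing.

(** * Counting blocks *)

Section Blocks.
Variable d : nat.

Definition idx n := {ffun 'I_d -> 'I_n}.

Definition emb n (c : idx n) : lattice d := [ffun i => (c i : nat)%:Z].

Lemma embE n (c : idx n) i : emb c i = (c i : nat)%:Z.
Proof. by rewrite ffunE. Qed.

Lemma emb_inj n : injective (@emb n).
Proof.
move=> c c' E; apply/ffunP => i; apply: val_inj.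
by have := congr1 (fun s : lattice d => s i) E; rewrite !embE => -[].
Qed.

Lemma emb_cube n (c : idx n) : cube n (emb c).
Proof. by move=> i; rewrite embE; have := ltn_ord (c i); lia. Qed.

Lemma cube_emb n s : cube n s -> exists c : idx n, s = emb c.
Proof.
move=> h; have lt i : (absz (s i) < n)%N by move: (h i); lia.
exists [ffun i => Ordinal (lt i)]; apply: latP => i.
by rewrite embE ffunE /=; move: (h i); lia.
Qed.

Lemma card_idx n : #|{: idx n}| = (n ^ d)%N.
Proof. by rewrite card_ffun !card_ord. Qed.

Variable A : finType.
Definition blk n := {ffun idx n -> A}.

Definition block_of (x : lattice d -> A) n v : blk n := [ffun c => x (v + emb c)].

Variable X : set (config d A).
Hypothesis Xshift : forall t x, X x -> X (shift_act t x).

(** Locked, so that rewriting membership in sets of blocks does not unfold it. *)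
Definition blocks n : {set blk n} :=
  locked [set b : blk n | `[< exists2 x, X x & block_of x n 0 = b >]]%SET.

Lemma blocksP n b : reflect (exists2 x, X x & block_of x n 0 = b) (b \in blocks n).
Proof. by rewrite /blocks -lock inE; exact: asboolP. Qed.

Lemma block_in x n v : X x -> block_of x n v \in blocks n.
Proof.
move=> Xx; apply/blocksP; exists (shift_act v x); first exact: Xshift.
by apply/ffunP => c; rewrite !ffunE /shift_act add0r addrC.
Qed.

(* k^d subcubes of side m with corners on p Z^d, inside a cube of side n *)
Section Sub.
Variables (k m p n : nat).
Hypothesis hpos : forall (c : 'I_k) (s : 'I_m), (c * p + s < n)%N.
Hypothesis mp : (m <= p)%N.

Definition pos (c : idx k) (s : idx m) : idx n :=
  [ffun i => Ordinal (hpos (c i) (s i))].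

Lemma emb_pos c s : emb (pos c s) = emb c *+ p + emb s.
Proof. by apply: latP => i; rewrite latD latMn !embE ffunE /= PoszD PoszM mulrC. Qed.

Lemma pos_inj c s c' s' : pos c s = pos c' s' -> c = c' /\ s = s'.
Proof.
move=> E; suff h i : c i = c' i /\ s i = s' i.
  by split; apply/ffunP => i; have [] := h i.
have := congr1 (fun f : idx n => (f i : nat)) E; rewrite !ffunE /=.
have := ltn_ord (s i); have := ltn_ord (s' i) => h h' e.
suff E' : (c i = c' i :> nat) /\ (s i = s' i :> nat).
  by case: E' => e1 e2; split; apply: val_inj.
have p0 : (0 < p)%N by apply: leq_trans mp; apply: leq_trans h'.
have c_eq : (c i = c' i :> nat).
  have := congr1 (divn^~ p) e; rewrite !divnMDl // !divn_small ?addn0 //.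
    exact: leq_trans mp.
  exact: leq_trans mp.
by split=> //; move: e; rewrite c_eq => /addnI.
Qed.

Definition subblock (P : blk n) (c : idx k) : blk m := [ffun s => P (pos c s)].

Definition gapset : {set idx n} :=
  ~: [set pos cs.1 cs.2 | cs : idx k * idx m].

Lemma gapP z : z \notin gapset -> exists c s, z = pos c s.
Proof. by rewrite inE negbK => /imsetP[[c s] _ ->]; exists c, s. Qed.

Lemma card_gapset : #|gapset| = (n ^ d - (k * m) ^ d)%N.
Proof.
rewrite -(card_idx n) -(cardsC gapset) finset.setCK card_imset.
  by rewrite card_prod !card_idx -expnMn addnK.
by move=> [c s] [c' s'] /= /pos_inj[-> ->].
Qed.

Lemma subblock_in P c : P \in blocks n -> subblock P c \in blocks m.
Proof.
move=> /blocksP[x Xx <-]; rewrite (_ : subblock _ c = block_of x m (emb c *+ p)).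
  exact: block_in.
by apply/ffunP => s; rewrite !ffunE add0r emb_pos.
Qed.

(** The first factor counts the subcubes over D, each of which is itself a block of X;
the second counts the values at the sites outside all subcubes, about which
nothing is known. *)
Lemma card_blocks_le (a0 : A) (D : {set idx k}) (S : {set blk n}) :
  S \subset blocks n ->
  {in S &, forall P P', (forall c, c \in D -> subblock P c = subblock P' c) ->
     {in gapset, P =1 P'} -> P = P'} ->
  (#|S| <= #|blocks m| ^ #|D| * #|A| ^ (n ^ d - (k * m) ^ d))%N.
Proof.
move=> Sb inj; rewrite -card_gapset.
pose y0 : blk m := [ffun=> a0].
pose th (P : blk n) : {ffun idx k -> blk m} * blk n :=
  ([ffun c => if c \in D then subblock P c else y0],
   [ffun z => if z \in gapset then P z else a0]).
have th_inj : {in S &, injective th}.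
  move=> P P' PS PS' [/ffunP E1 /ffunP E2]; apply: inj => // [c cD|z zg].
    by have := E1 c; rewrite !ffunE cD.
  by have := E2 z; rewrite !ffunE zg.
rewrite -(card_in_imset th_inj).
rewrite -(card_pffun_on y0 D (pred_of_set (blocks m))) -(card_pffun_on a0 gapset predT) -cardX.
apply: subset_leq_card; apply/fintype.subsetP => _ /imsetP[P PS ->].
rewrite !inE /=; apply/andP; split; apply/pffun_onP; split.
- by apply/supportP => c; rewrite ffunE => /negbTE ->.
- move=> _ /fintype.imageP[c cD ->]; rewrite ffunE cD.
  by apply: subblock_in; apply: (fintype.subsetP Sb).
- by apply/supportP => c; rewrite ffunE => /negbTE ->.
- by move=> ? _; rewrite inE.
Qed.

Lemma card_blocks_ge :
  (forall f : {ffun idx k -> blk m}, (forall c, f c \in blocks m) ->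
    exists2 P, P \in blocks n & forall c, subblock P c = f c) ->
  (#|blocks m| ^ (k ^ d) <= #|blocks n|)%N.
Proof.
move=> h; rewrite -card_idx -(card_ffun_on (idx k) (pred_of_set (blocks m))).
pose rho (P : blk n) : {ffun idx k -> blk m} := [ffun c => subblock P c].
apply: leq_trans (leq_imset_card rho _).
apply: subset_leq_card; apply/fintype.subsetP => f /ffun_onP hf.
have [P Pb E] := h f hf; apply/imsetP; exists P => //.
by apply/ffunP => c; rewrite ffunE E.
Qed.
End Sub.
End Blocks.

(** * A rarely occurring block without self-overlaps *)

Lemma corner_lt i g (c : 'I_2) (s : 'I_i) : (c * (i + g) + s < i + i + g)%N.
Proof.
have := ltn_ord s; have : (c <= 1)%N by rewrite -ltnS; exact: ltn_ord.
by case: (c : nat) => [|[|]] //; lia.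
Qed.

Section Marker.
Variables (d : nat) (A : finType) (X : set (config d A)).
Hypothesis Xshift : forall t x, X x -> X (shift_act t x).
Variables (i g : nat) (a0 : A).
Let l := (i + i + g)%N.
Let N n := #|blocks X n|.

Definition corner (c : idx d 2) (s : idx d i) : idx d l := pos (@corner_lt i g) c s.

(** The corner c of P occurs at position t of U; the position is such that the whole
translated corner lies inside U. *)
Definition hit (c : idx d 2) (t : idx d l) (P U : blk d A l) :=
  [forall s : idx d i, [exists z : idx d l,
    (emb z == emb t + emb s) && (U z == P (corner c s))]].

Lemma hitP c t (P U : blk d A l) :
  reflect (forall s, exists2 z, emb z = emb t + emb s & U z = P (corner c s))
          (hit c t P U).
Proof.
apply: (iffP forallP) => h s.
  by have /existsP[z /andP[/eqP e1 /eqP e2]] := h s; exists z.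
by have [z e1 e2] := h s; apply/existsP; exists z; rewrite e1 e2 !eqxx.
Qed.

Definition corner_determined_bound := (N i ^ (2 ^ d - 1) * #|A| ^ (l ^ d - (2 * i) ^ d))%N.
Let K := corner_determined_bound.

(** With one corner determined by the rest, only 2^d - 1 corners remain free. *)
Lemma corner_count (c : idx d 2) (S : {set blk d A l}) :
  S \subset blocks X l ->
  {in S &, forall P P' : blk d A l, (forall z, (forall s, z <> corner c s) -> P z = P' z) ->
    P = P'} ->
  (#|S| <= K)%N.
Proof.
move=> Sb inj.
have cD : #|~: [set c]| = (2 ^ d - 1)%N.
  by rewrite cardsC1 card_idx subn1.
rewrite /K /corner_determined_bound -cD.
apply: (@card_blocks_le d A X Xshift 2 i (i + g) l (@corner_lt i g) (leq_addr _ _) a0) => //.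
move=> P P' PS PS' sub gap; apply: inj => // z zc.
have [zg|/gapP[c' [s zE]]] := boolP (z \in gapset d (@corner_lt i g)); first exact: gap.
have c'D : c' \in ~: [set c].
  by rewrite !inE; apply/eqP => cc'; apply: (zc s); rewrite zE cc'.
by have /ffunP/(_ s) := sub c' c'D; rewrite !ffunE zE.
Qed.

Lemma hit_count U c t : (#|[set P in blocks X l | hit c t P U]| <= K)%N.
Proof.
apply: (corner_count (c := c)).
  by apply/fintype.subsetP => P; rewrite inE => /andP[].
move=> P P'; rewrite !inE => /andP[_ /hitP h] /andP[_ /hitP h'] out.
apply/ffunP => z.
have [[s ->]|/forallNP zc] := pselect (exists s, z = corner c s); last exact: out.
have [z1 e1 <-] := h s; have [z2 e2 <-] := h' s.
by congr (U _); apply: emb_inj; rewrite e1 e2.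
Qed.

(** If a corner of P reoccurs in P at another place, possibly overlapping itself, the
values on the corner are copied from elsewhere and hence determined by the values
outside the corner. *)
Lemma selfhit_count c t : emb t <> emb c *+ (i + g) ->
  (#|[set P in blocks X l | hit c t P P]| <= K)%N.
Proof.
move=> tc; apply: (corner_count (c := c)).
  by apply/fintype.subsetP => P; rewrite inE => /andP[].
move=> P P'; rewrite !inE => /andP[_ /hitP h] /andP[_ /hitP h'] out.
(* iterating the translation by emb t - emb c *+ (i + g) leaves the corner *)
have [j tj] : exists j, emb t j <> (emb c *+ (i + g)) j.
  by apply/existsNP => E; apply: tc; apply: latP.
(* the translation moves sites monotonically along coordinate j *)
pose mu (z : idx d l) := if emb t j > (emb c *+ (i + g)) j then (l - z j)%N else z j : nat.
apply/ffunP => z; have [m] := ubnP (mu z).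
elim: m z => // m IH z hm.
have [[s zs]|/forallNP zc] := pselect (exists s, z = corner c s); last exact: out.
have [z1 e1 E1] := h s; have [z2 e2 E2] := h' s.
rewrite zs -E1 -E2.
have <- : z1 = z2 by apply: emb_inj; rewrite e1 e2.
apply: IH; apply: leq_trans (_ : (mu z1 < mu z)%N) _; last by rewrite ltnS in hm.
have F1 := congr1 (fun f : lattice d => f j) e1.
have F2 : emb z j = (emb c *+ (i + g)) j + emb s j by rewrite zs emb_pos latD.
move: F1; rewrite latD embE => F1.
move: F2; rewrite embE => F2.
have := ltn_ord (z j); have := ltn_ord (z1 j).
rewrite /mu; case: ltP; lia.
Qed.

Definition avoiding P : {set blk d A l} :=
  [set U in blocks X l | [forall c, forall t, ~~ hit c t P U]].

(** Double counting of the pairs (P, U) such that some corner of P occurs in U: for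
each U few P qualify, hence for an average P few U do.  The factor 3 leaves room
for also excluding the P whose corners reoccur in P itself. *)
Lemma marker_exists :
  (3 * (2 ^ d * l ^ d * K) <= N l)%N -> (0 < N l)%N ->
  exists P, [/\ P \in blocks X l,
    forall c t, hit c t P P -> emb t = emb c *+ (i + g)
    & (N l <= 2 * #|avoiding P|)%N].
Proof.
move=> le3 N0; set E := (2 ^ d * l ^ d * K)%N in le3.
pose ok (ct : idx d 2 * idx d l) := `[< emb ct.2 = emb ct.1 *+ (i + g) >].
pose bad := [set P in blocks X l | [exists ct, ~~ ok ct && hit ct.1 ct.2 P P]].
have cardE (S : idx d 2 * idx d l -> {set blk d A l}) :
    (forall ct, (#|S ct| <= K)%N) -> (#|(\bigcup_ct S ct)%SET| <= E)%N.
  move=> h; apply: (@leq_trans (\sum_(ct : idx d 2 * idx d l) K)).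
    elim/big_ind2 : _ => [|s1 n1 s2 n2 h1 h2|ct _]; [by rewrite cards0| |exact: h].
    by apply: leq_trans (leq_card_setU _ _) _; exact: leq_add.
  by rewrite sum_nat_const card_prod !card_idx.
have badE : (#|bad| <= E)%N.
  apply: leq_trans (cardE (fun ct => if ok ct then finset.set0 else
    [set P in blocks X l | hit ct.1 ct.2 P P]) _).
    apply: subset_leq_card; apply/fintype.subsetP => P.
    rewrite inE => /andP[Pb /existsP[ct /andP[nok h]]].
    apply/finset.bigcupP; exists ct => //; rewrite (negbTE nok) inE Pb.
    exact: h.
  move=> ct; case: ifPn => [_|/asboolP]; first by rewrite cards0.
  exact: selfhit_count.
pose good := blocks X l :\: bad.
have hitE U : (#|[set P in blocks X l | U \in blocks X l :\: avoiding P]| <= E)%N.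
  apply: leq_trans (cardE (fun ct => [set P in blocks X l | hit ct.1 ct.2 P U]) _).
    apply: subset_leq_card; apply/fintype.subsetP => P.
    rewrite !inE => /andP[Pb]; case Ub : (U \in blocks X l); last by rewrite andbF.
    rewrite andbT /= => /forallPn[c /forallPn[t]]; rewrite negbK => h.
    by apply/finset.bigcupP; exists (c, t) => //; rewrite inE Pb.
  by move=> ct; exact: hit_count.
have [/existsP[P /andP[Pg PN]]|/existsPn none] :=
    boolP [exists P, (P \in good) && (N l <= 2 * #|avoiding P|)%N].
  move: Pg; rewrite !inE => /andP[nbad Pb]; exists P; split=> // c t h.
  apply: contrapT => ne; move/negP: nbad; apply; rewrite Pb /=.
  by apply/existsP; exists (c, t); rewrite h andbT; apply/asboolP.
exfalso.
have sumle : (\sum_(P in blocks X l) #|blocks X l :\: avoiding P| <= N l * E)%N.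
  rewrite (eq_bigr (fun P =>
    \sum_(U in blocks X l | U \in blocks X l :\: avoiding P) 1)%N); last first.
    move=> P _; rewrite sum1dep_card; apply: eq_card => U.
    by rewrite !inE; case: (U \in blocks X l); rewrite ?andbF ?andbT.
  rewrite (exchange_big_dep (mem (blocks X l))) /=; last by move=> P U _ /andP[].
  rewrite -sum_nat_const; apply: leq_sum => U Ub.
  rewrite sum1dep_card; apply: leq_trans (hitE U); apply: subset_leq_card.
  by apply/fintype.subsetP => P; rewrite !inE => /and3P[-> _ ->].
have sumge : (#|good| * (N l).+1 <= 2 * \sum_(P in blocks X l) #|blocks X l :\: avoiding P|)%N.
  rewrite -sum_nat_const big_distrr /=.
  apply: (@leq_trans (\sum_(P in good) (2 * #|blocks X l :\: avoiding P|))%N).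
    apply: leq_sum => P Pg; have := none P; rewrite Pg /= -ltnNge => lt.
    rewrite cardsD (finset.setIidPr _); last first.
      by apply/fintype.subsetP => U; rewrite inE => /andP[].
    rewrite mulnBr -/(N l); move: lt; move: (N l) #|avoiding P| => n1 n2.
    by clear; lia.
  by rewrite [leqRHS](big_setID bad) leq_addl.
have goodge : (N l - E <= #|good|)%N.
  rewrite cardsD; apply: leq_sub2l; apply: leq_trans badE.
  by apply: subset_leq_card; exact: finset.subsetIr.
have {}sumge := leq_trans sumge (leq_mul (leqnn 2) sumle).
move: le3 N0 sumge goodge; move: (N l) #|good| => n G; clear; nia.
Qed.
End Marker.

(** * Coding through markers *)

(** In each coordinate an interval of length 2 i + g meets at most one gap of width g
of the grid with period 2 i + 2 g, so its initial or its final segment of length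
i is free of gaps. *)
Lemma corner_cell (d i g : nat) (p : lattice d) : (0 < i)%N ->
  exists (q : lattice d) (c : idx d 2) (t : idx d (i + i + g)),
    p + emb c *+ (i + g) = q *+ (i + i + g + g) + emb t /\
    forall s : idx d i, exists z : idx d (i + i + g), emb z = emb t + emb s.
Proof.
move=> i0; pose L : int := (i + i + g + g)%N.
have cell (x : int) : exists h : int * 'I_2 * 'I_(i + i + g),
    x + (i + g)%:Z * (h.1.2 : nat)%:Z = L * h.1.1 + (h.2 : nat)%:Z /\
    (h.2 + i <= i + i + g)%N.
  have := divz_eq x L; have := modz_ge0 x (_ : L != 0).
  have := ltz_pmod x (_ : 0 < L); set q := divz _ _; set m := modz _ _.
  move=> mL m0 xE; have {}m0 : 0 <= m by apply: m0; rewrite /L; lia.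
  have {}mL : m < L by apply: mL; rewrite /L; lia.
  have [le|gt] := leqP (absz m) (i + g).
    have lt : (absz m < i + i + g)%N by lia.
    by exists (q, ord0, Ordinal lt); split=> /=; lia.
  have lt : (absz m - (i + g) < i + i + g)%N by move: mL; rewrite /L; lia.
  exists (q + 1, lift ord0 ord0, Ordinal lt); split=> /=.
    by rewrite /bump /= xE; move: mL; rewrite /L; nia.
  by move: mL; rewrite /L; lia.
have [h hP] := choice (fun j => cell (p j)).
exists [ffun j => (h j).1.1], [ffun j => (h j).1.2], [ffun j => (h j).2]; split.
  apply: latP => j; have [E _] := hP j.
  by move: E; rewrite !latD !latMn !embE !ffunE.
move=> s; have lt j : ((h j).2 + s j < i + i + g)%N.
  by have [_ le] := hP j; apply: leq_trans le; rewrite ltn_add2l.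
exists [ffun j => Ordinal (lt j)]; apply: latP => j.
by rewrite latD !embE !ffunE.
Qed.

Lemma finite_surjection (T1 T2 : finType) (t1 : T1) (S1 : {set T1}) (S2 : {pred T2}) :
  (#|S1| <= #|S2|)%N ->
  exists f : T2 -> T1, forall s, s \in S1 -> exists2 q, q \in S2 & f q = s.
Proof.
move=> le; exists (fun q => nth t1 (enum S1) (index q (enum S2))) => s sS.
have si : (index s (enum S1) < size (enum S2))%N.
  by rewrite -cardE; apply: leq_trans le; rewrite cardE index_mem mem_enum.
have [q0 _] : exists q : T2, q \in enum S2.
  by case: (enum S2) si => [|q0 r _] //; exists q0; rewrite inE eqxx.
exists (nth q0 (enum S2) (index s (enum S1))).
  by rewrite -mem_enum mem_nth.
by rewrite index_uniq ?enum_uniq // nth_index // mem_enum.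
Qed.

Lemma divmod_grid (d a : nat) (q : lattice d) : (0 < a)%N ->
  exists vc : lattice d * idx d a, q = vc.1 *+ a + emb vc.2.
Proof.
move=> a0; have lt j : (absz (modz (q j) a) < a)%N.
  have := modz_ge0 (q j) (_ : a%:Z != 0); have := ltz_pmod (q j) (_ : 0 < a%:Z).
  by move=> h h'; have {}h := h _; have {}h' := h' _; lia.
exists ([ffun j => divz (q j) a], [ffun j => Ordinal (lt j)]).
apply: latP => j; rewrite latD latMn embE !ffunE /=.
have := divz_eq (q j) a; have := modz_ge0 (q j) (_ : a%:Z != 0).
by move=> h'; have {}h' := h' _; lia.
Qed.

Lemma grid_unique (d n : nat) (v v' r r' : lattice d) :
  cube n r -> cube n r' -> v *+ n + r = v' *+ n + r' -> v = v' /\ r = r'.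
Proof.
move=> cr cr' E; suff h j : v j = v' j /\ r j = r' j.
  by split; apply: latP => j; have [] := h j.
have := congr1 (fun f : lattice d => f j) E; rewrite !latD !latMn.
have := cr j; have := cr' j.
case: (ltgtP (v j) (v' j)) => h; [nia|nia|].
by rewrite h; lia.
Qed.

Lemma inQ_emb d n (c : idx d n) : inQ n (emb c).
Proof. by move=> j; rewrite embE; have := ltn_ord (c j); lia. Qed.

Lemma inQ_cube d n (s : lattice d) : cube n s -> inQ n s.
Proof. by move=> h j; have := h j; lia. Qed.

Lemma inQM d r n (s : lattice d) : inQ r s -> inQ (n * r) (s *+ n).
Proof. by move=> h j; rewrite latMn abszM; apply: leq_mul. Qed.

Section Coding.
Variables (d : nat) (A B : finType) (i g a : nat).
Let l := (i + i + g)%N.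
Let L := (l + g)%N.
Let n := (L * a)%N.
Variable P : blk d A l.

(** The blocks on the a^d cells of one period. *)
Definition content := {ffun idx d a -> blk d A l}.

Definition occ (x : lattice d -> A) v := block_of x l v = P.

(** Isolated occurrences of P: separation holds by definition, in every point. *)
Definition marker (x : lattice d -> A) v :=
  occ x v /\ forall u, inQ n.-1 u -> occ x (v + u) -> u = 0.

Lemma block_of_local (x x' : lattice d -> A) m v v' :
  (forall u, inQ m u -> x (v + u) = x' (v' + u)) -> block_of x m v = block_of x' m v'.
Proof. by move=> h; apply/ffunP => c; rewrite !ffunE; apply/h/inQ_emb. Qed.

Lemma marker_sbc : sbc marker.
Proof.
exists (n + l)%N => x x' s s' h.
have E u : inQ n.-1 u -> occ x (s + u) = occ x' (s' + u).
  move=> hu; rewrite /occ; congr (_ = P); apply: block_of_local => w hw.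
  by rewrite -!addrA; apply: h; apply: inQS (inQD hu hw); rewrite leq_add2r leq_pred.
rewrite /marker; have := E 0 (@inQ0 _ _); rewrite !addr0 => ->.
apply/propext; split=> -[oc hu]; split=> // u uQ; first by rewrite -E //; exact: hu.
by rewrite E //; exact: hu.
Qed.

Lemma marker_separated x v v' :
  marker x v -> marker x v' -> inQ n.-1 (v - v') -> v = v'.
Proof.
move=> [oc h] [oc' h'] near; apply/eqP; rewrite -subr_eq0; apply/eqP.
by apply: h' => //; rewrite addrCA subrr addr0.
Qed.

Definition content_at (x : lattice d -> A) v : content :=
  [ffun c => block_of x l (v + emb c *+ L)].

Variables (b0 : B) (dec : content -> lattice d -> B).

(** The possible positions of s in a period cube based at a marker. *)
Definition anchors (x : lattice d -> A) s := [set r | cube n r /\ marker x (s - r)].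

Definition decoded (x : lattice d -> A) s : B :=
  if `[< anchors x s !=set0 >] then
    let r := xget 0 (anchors x s) in dec (content_at x (s - r)) r
  else b0.

Lemma decoded_sbc : sbc decoded.
Proof.
have [rM hM] := marker_sbc.
exists (rM + n + L * a + l)%N => x x' s s' h.
have C : anchors x s = anchors x' s'.
  apply/seteqP; split=> r -[rc Mr]; split=> //; move: Mr.
    rewrite (hM x x' _ (s' - r)) // => u hu; rewrite -!addrA; apply: h.
    by apply: inQS (inQD (inQN (inQ_cube rc)) hu); lia.
  rewrite (hM x x' _ (s' - r)) // => u hu; rewrite -!addrA; apply: h.
  by apply: inQS (inQD (inQN (inQ_cube rc)) hu); lia.
rewrite /decoded C; case: asboolP => // ne.
have rn : cube n (xget 0 (anchors x' s')).
  by case: xgetP => [? _ []|] //; case: ne => r h' /(_ r).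
congr (dec _ _); apply/ffunP => c; rewrite !ffunE; apply: block_of_local => u hu.
rewrite -!addrA; apply: h.
apply: inQS (inQD (inQN (inQ_cube rn)) (inQD (inQM _ (inQ_emb c)) hu)); lia.
Qed.

Lemma decoded_near x s : decoded x s <> b0 -> exists2 v, marker x v & inQ n (s - v).
Proof.
rewrite /decoded; case: asboolP => // -[r [rc Mr]] _.
by exists (s - r) => //; rewrite subKr; exact: inQ_cube.
Qed.

Variables (X : set (config d A)) (Y : set (config d B)).
Hypothesis Yshift : forall t y, Y y -> Y (shift_act t y).
Hypothesis a_gt0 : (0 < a)%N.

Definition code_content (e : content) := forall c,
  (emb c = 0 -> e c = P) /\ (emb c <> 0 -> e c \in avoiding X P).

Lemma decoder_exists :
  (#|blocks Y n| <= #|avoiding X P| ^ (a ^ d - 1))%N ->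
  exists dec : content -> lattice d -> B, forall y, Y y ->
  exists2 e, code_content e & forall r, cube n r -> dec e r = y r.
Proof.
move=> count.
pose c0 : idx d a := [ffun=> Ordinal a_gt0].
have c0E c : emb c = 0 <-> c = c0.
  have c00 : emb c0 = 0 by apply: latP => j; rewrite embE ffunE lat0.
  by split=> [|->//]; rewrite -c00 => /emb_inj.
have [|f fP] := @finite_surjection _ _ [ffun=> b0] (blocks Y n)
    (pffun_on P (pred_of_set [set~ c0]%SET) (pred_of_set (avoiding X P))).
  by rewrite card_pffun_on cardsC1 card_idx -subn1.
exists (fun e r => if [pick c | emb c == r] is Some c then f e c else b0) => y Yy.
have [e ePS eE] := fP _ (block_in Yshift n 0 Yy).
have [sup val] := pffun_onP ePS.
exists e => [c|r /cube_emb[c rc]].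
  split=> [/c0E ->|nc].
    apply: contrapT => /eqP ne; have := fintype.subsetP sup c0 ne.
    by rewrite !inE eqxx.
  have cD : c \in [set~ c0]%SET by rewrite !inE; apply/eqP => /c0E.
  by apply: val; apply: fintype.image_f.
case: pickP => [c' /eqP E|/(_ c)]; last by rewrite rc eqxx.
by rewrite eE ffunE add0r E.
Qed.

Hypothesis i0 : (0 < i)%N.
Hypothesis Xgrid : forall u : lattice d -> config d A, (forall v, X (u v)) ->
  exists2 x, X x & forall v s, cube l s -> x (v *+ L + s) = u v s.
Hypothesis Pin : P \in blocks X l.
Hypothesis Pself : forall c t, hit c t P P -> emb t = emb c *+ (i + g).
Hypothesis decP : forall y, Y y ->
  exists2 e, code_content e & forall r, cube n r -> dec e r = y r.

Lemma avoiding_blocks U : U \in avoiding X P -> U \in blocks X l.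
Proof. by rewrite inE => /andP[]. Qed.

(** In the point that carries P on n Z^d and encodes y on the remaining cells, P has no
other occurrence: the corner of a stray occurrence would lie in one cell, which
can only be a marker cell, and there at its own place. *)
Lemma decoded_onto y : Y y -> exists2 x, X x & decoded x = y.
Proof.
move=> Yy.
have exE (v : lattice d) : exists e, code_content e /\
    forall r, cube n r -> dec e r = y (v *+ n + r).
  have [e ce de] := decP (Yshift (v *+ n) Yy).
  by exists e; split=> // r /de ->; rewrite /shift_act addrC.
have [E EP] := choice exE.
have exvc (q : lattice d) : exists vc : lattice d * idx d a,
    q = vc.1 *+ a + emb vc.2 by exact: divmod_grid.
have [vc vcE] := choice exvc.
have exu q : exists x, X x /\ block_of x l 0 = E (vc q).1 (vc q).2.
  have [ce _] := EP (vc q).1.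
  have : E (vc q).1 (vc q).2 \in blocks X l.
    have [z nz] := ce (vc q).2.
    by have [/z ->//|/nz/avoiding_blocks//] := pselect (emb (vc q).2 = 0).
  by move=> /blocksP[x Xx xb]; exists x.
have [u uP] := choice exu.
have [x Xx xP] := Xgrid (fun q => proj1 (uP q)).
have cellE v c : block_of x l ((v *+ a + emb c) *+ L) = E v c.
  set q := _ + _; have [_ ub] := uP q.
  have [ev ec] : v = (vc q).1 /\ c = (vc q).2.
    have [e1 /emb_inj e2] := grid_unique (emb_cube c) (emb_cube (vc q).2) (vcE q).
    by [].
  rewrite ev ec -ub; apply/ffunP => s; rewrite !ffunE add0r.
  by apply: xP; exact: emb_cube.
pose c0 : idx d a := [ffun=> Ordinal a_gt0].
have c00 : emb c0 = 0 by apply: latP => j; rewrite embE ffunE lat0.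
have mulE (v : lattice d) : v *+ n = v *+ a *+ L.
  by apply: latP => j; rewrite !latMn /n PoszM mulrA.
have occE p : occ x p <-> exists v, p = v *+ n.
  split=> [op|[v ->]]; last first.
    have := cellE v c0; rewrite c00 addr0 -mulE /occ => ->.
    by have [/(_ c0)[/(_ c00)]] := EP v.
  have [q [c [t [pE zt]]]] := corner_cell g p i0.
  have h : hit c t P (E (vc q).1 (vc q).2).
    apply/hitP => s; have [z zE] := zt s; exists z => //.
    rewrite -cellE -vcE -op !ffunE zE emb_pos; congr x.
    by rewrite addrA -pE addrA.
  have [ce _] := EP (vc q).1; have [ze nz] := ce (vc q).2.
  have [c_eq0|/nz] := pselect (emb (vc q).2 = 0); last first.
    by rewrite inE => /andP[_ /forallP/(_ c)/forallP/(_ t)]; rewrite h.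
  rewrite ze // in h; have tE := Pself h.
  exists (vc q).1; rewrite mulE.
  have qE : q = (vc q).1 *+ a by rewrite {1}(vcE q) c_eq0 addr0.
  by move: pE; rewrite tE => /addIr ->; rewrite {1}qE.
exists x => //; apply/funext => s.
have L0 : (0 < L)%N by rewrite /L /l; lia.
have n0 : (0 < n)%N by rewrite /n muln_gt0 L0.
have [[v r'] /= sE] := divmod_grid s n0.
set r := emb r' in sE; have rc : cube n r by exact: emb_cube.
have cub0 : cube n (0 : lattice d) by move=> j; rewrite lat0; lia.
have mk v0 : marker x (v0 *+ n).
  split=> [|w hw /occE[v1 e]]; first by apply/occE; exists v0.
  have wE : w = (v1 - v0) *+ n by rewrite mulrnBl -e addrC addKr.
  have -> : w = 0 *+ n; last by rewrite mul0rn.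
  rewrite wE; congr (_ *+ n); apply: latP => j; rewrite lat0.
  have := hw j; rewrite wE latMn; set z := (v1 - v0) j => hz.
  by case: (ltgtP z 0) => hh //; nia.
have uniq r1 : anchors x s r1 -> r1 = r.
  move=> [r1c [/occE[v1 e] _]].
  have e1 : v *+ n + r = v1 *+ n + r1 by rewrite -e subrK.
  by have [_ ->] := grid_unique rc r1c e1.
have ar : anchors x s r by split=> //; rewrite sE addrK.
rewrite /decoded asboolT; last by exists r.
have -> : xget 0 (anchors x s) = r.
  by case: xgetP => [r1 _ /uniq//|/(_ r)].
have [_ dE] := EP v.
rewrite sE addrK -dE //; congr dec; apply/ffunP => c; rewrite ffunE.
by rewrite mulE -mulrnDl cellE.
Qed.
End Coding.

(** * Block counts and entropy *)

Section Language.
Variables (d : nat) (A : finType) (X : set (config d A)).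
Hypothesis Xshift : forall t x, X x -> X (shift_act t x).

Definition block_pattern n (b : blk d A n) : pattern d A :=
  fun s => if [pick c | emb c == s] is Some c then Some (b c) else None.

Lemma block_pattern_emb n (b : blk d A n) c : block_pattern b (emb c) = Some (b c).
Proof.
rewrite /block_pattern; case: pickP => [c' /eqP/emb_inj -> //|/(_ c)].
by rewrite eqxx.
Qed.

Lemma block_pattern_out n (b : blk d A n) s : ~ cube n s -> block_pattern b s = None.
Proof.
rewrite /block_pattern; case: pickP => [c /eqP <-|//] nc.
by case: nc; exact: emb_cube.
Qed.

Lemma block_pattern_inj n : injective (@block_pattern n).
Proof.
move=> b b' E; apply/ffunP => c; have := congr1 (fun w => w (emb c)) E.
by rewrite !block_pattern_emb => -[].
Qed.

Lemma language_on_cube n : language_on (cube n) X =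
  [set block_pattern b | b in [set` blocks X n]].
Proof.
apply/seteqP; split=> [w [[x Xx [S [t E]]] shw]|w [b /blocksP[x Xx <-] <-]].
  exists (block_of x n t); first exact: block_in.
  apply/funext => s; have [cs|ncs] := pselect (cube n s).
    have [c sc] := cube_emb cs; rewrite sc block_pattern_emb ffunE.
    have := congr1 (fun w => w (s + t)) E; rewrite /translate /restr addrK.
    have : w s != None by have : shape w s by rewrite shw.
    case: asboolP => [_ _|_ + e]; last by rewrite -e.
    by rewrite -sc => <-; rewrite addrC.
  rewrite block_pattern_out //; apply/esym/eqP; apply: contrapT => /negP.
  by move=> h; apply: ncs; rewrite -shw.
split.
  exists x => //; exists (cube n), 0; apply/funext => s.
  rewrite /translate subr0 /restr; case: asboolP => [cs|ncs].
    have [c ->] := cube_emb cs; rewrite block_pattern_emb ffunE add0r //.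
  by rewrite block_pattern_out.
apply/seteqP; split=> s; rewrite /shape /=.
  by move=> h; apply: contrapT => /(block_pattern_out (block_of x n 0)) e; rewrite e in h.
by move=> /cube_emb[c ->]; rewrite block_pattern_emb.
Qed.

Lemma card_language n : #|` fset_set (language_on (cube n) X)| = #|blocks X n|.
Proof.
have fin : finite_set (language_on (cube n) X).
  by rewrite language_on_cube; apply: finite_image; exact: finite_finset.
have -> : fset_set (language_on (cube n) X) =
    [fset block_pattern b | b in blocks X n]%fset.
  apply/fsetP => w; rewrite in_fset_set // language_on_cube.
  apply/idP/imfsetP => [/set_mem[b bX <-]|[b bX ->]]; first by exists b.
  by apply/mem_set; exists b.
by rewrite card_imfset ?cardE //; exact: block_pattern_inj.
Qed.
End Language.

Lemma pow_diff a b d : (a <= b)%N -> (b ^ d <= a ^ d + d * (b - a) * b ^ d.-1)%N.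
Proof.
move=> ab; elim: d => [|[|d] IH]; first by rewrite !expn0.
  by rewrite !expn1 mul1n expn0 muln1 subnKC.
rewrite expnS; apply: leq_trans (leq_mul (leqnn b) IH) _.
rewrite mulnDr /= [(a ^ d.+2)%N]expnS.
have := leq_exp2r a b (ltn0Sn d); rewrite ab => h.
rewrite [(b ^ d.+1)%N]expnS in h *.
set p := (a ^ d.+1)%N in h *; set q := (b ^ d)%N in h *.
have : (b * p <= a * p + (b - a) * (b * q))%N.
  by rewrite -{1}(subnKC ab) mulnDl leq_add2l leq_mul2l h orbT.
nia.
Qed.

Section Entropy.
Variables (R : realType) (d : nat).
Hypothesis d0 : (0 < d)%N.

Section Upper.
Variables (A : finType) (X : set (config d A)).
Hypothesis Xshift : forall t x, X x -> X (shift_act t x).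
Variable x0 : config d A.
Hypothesis Xx0 : X x0.
Let N n := #|blocks X n|.

Lemma blocks_gt0 n : (0 < N n)%N.
Proof. by apply/card_gt0P; exists (block_of x0 n 0); exact: block_in. Qed.

(** Disjoint cubes of side m cover all but n^d - (k m)^d sites of a cube of side n. *)
Lemma blocks_submul k m n : (k * m <= n)%N ->
  (N n <= N m ^ (k ^ d) * #|A| ^ (n ^ d - (k * m) ^ d))%N.
Proof.
move=> kmn.
have hpos (c : 'I_k) (s : 'I_m) : (c * m + s < n)%N.
  apply: leq_trans kmn; apply: (@leq_trans (c.+1 * m)).
    by rewrite mulSn addnC ltn_add2r.
  by rewrite leq_mul2r ltn_ord orbT.
rewrite -(card_idx d k) -(cardsT (idx d k)).
apply: (@card_blocks_le d A X Xshift k m m n hpos (leqnn m) (x0 0)) => //.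
move=> P P' _ _ sub gap; apply/ffunP => z.
have [zg|/gapP[c [s ->]]] := boolP (z \in gapset d hpos); first exact: gap.
by have /ffunP/(_ s) := sub c (finset.in_setT _); rewrite !ffunE.
Qed.

Definition rate n : R := ln (N n)%:R / n%:R ^+ d.

Lemma lnN_ge0 n : 0 <= ln ((N n)%:R : R).
Proof. by apply: ln_ge0; rewrite ler1n; exact: blocks_gt0. Qed.

Lemma rate_ge0 n : 0 <= rate n.
Proof. by apply: divr_ge0; [exact: lnN_ge0|exact: exprn_ge0]. Qed.

Lemma lnN_rate n : (0 < n)%N -> ln ((N n)%:R : R) = rate n * n%:R ^+ d.
Proof. by move=> n0; rewrite /rate divfK // expf_neq0 // pnatr_eq0 -lt0n. Qed.

(** For k the quotient of n by m, the leftover volume n^d - (k m)^d is of order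
n^(d-1), so it is negligible against n^d. *)
Lemma rate_le m (e : R) : (0 < m)%N -> 0 < e ->
  \forall n \near \oo, rate n <= rate m + e.
Proof.
move=> m0 e0.
have A1 : (0 < #|A|)%N by apply/card_gt0P; exists (x0 0).
set lA : R := ln (#|A|%:R).
have lA0 : 0 <= lA by apply: ln_ge0; rewrite ler1n.
(* the n above which the leftover volume is worth less than e *)
pose C : R := (d * m)%N%:R * lA / e.
near=> n.
have n0 : (0 < n)%N by near: n; exists 1%N.
have nC : C <= n%:R by near: n; exact: nbhs_infty_ger.
set k := (n %/ m)%N.
have kmn : (k * m <= n)%N by exact: leq_trunc_div.
have nm : (n - k * m <= m)%N.
  by rewrite leq_subLR {1}(divn_eq n m) leq_add2l ltnW // ltn_mod.
have diff : (n ^ d - (k * m) ^ d <= d * m * n ^ d.-1)%N.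
  rewrite leq_subLR; apply: leq_trans (pow_diff d kmn) _.
  by rewrite leq_add2l leq_mul // leq_mul.
have nd0 : 0 < (n%:R : R) ^+ d by rewrite exprn_gt0 // ltr0n.
rewrite {1}/rate ler_pdivrMr //.
apply: (@le_trans _ _ ((k ^ d)%N%:R * ln (N m)%:R + (n ^ d - (k * m) ^ d)%N%:R * lA)).
  apply: (@le_trans _ _ (ln (N m ^ (k ^ d) * #|A| ^ (n ^ d - (k * m) ^ d))%N%:R)).
    rewrite ler_ln ?posrE ?ltr0n ?blocks_gt0 //.
      by rewrite ler_nat; exact: blocks_submul.
    by rewrite muln_gt0 !expn_gt0 blocks_gt0 A1.
  move: (k ^ d)%N (n ^ d - _)%N => K D; rewrite natrM !natrX.
  rewrite lnM ?posrE ?exprn_gt0 ?ltr0n ?blocks_gt0 //.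
  by rewrite !lnXn ?ltr0n ?blocks_gt0 // !mulr_natl.
rewrite mulrDl lerD //.
  rewrite lnN_rate // mulrCA ler_wpM2l ?rate_ge0 //.
  by rewrite -!natrX -natrM ler_nat -expnMn leq_exp2r.
apply: (@le_trans _ _ ((d * m * n ^ d.-1)%N%:R * lA)).
  by rewrite ler_wpM2r // ler_nat.
rewrite -(prednK d0) exprS /= prednK // mulrA natrM natrX mulrAC ler_pM2r; last first.
  by rewrite exprn_gt0 // ltr0n.
by move: nC; rewrite /C ler_pdivrMr // [n%:R * e]mulrC.
Unshelve. all: by end_near. Qed.

(** By [rate_le] the infimum of the rates is also an upper limit. *)
Lemma rate_cvg : exists2 h : R, 0 <= h & rate @ \oo --> h.
Proof.
pose S := rate @` [set m | (0 < m)%N].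
have S0 : S !=set0 by exists (rate 1), 1%N.
have lbS : lbound S 0 by move=> _ [m _ <-]; exact: rate_ge0.
have hlb : has_lbound S by exists 0.
exists (inf S); first exact: lb_le_inf.
apply/cvgrPdist_le => e e0.
have e2 : 0 < e / 2 by rewrite divr_gt0.
have [_ [m m0 <-] hm] := inf_adherent e2 (conj S0 hlb).
near=> n.
have n0 : (0 < n)%N by near: n; exists 1%N.
have ub : rate n <= rate m + e / 2 by near: n; exact: rate_le.
have lb : inf S <= rate n by apply: ge_inf => //; exists n.
rewrite distrC ger0_norm ?subr_ge0 // lerBlDl.
by apply: le_trans ub _; move: hm; lra.
Unshelve. all: by end_near. Qed.

Lemma entropy_rate n : (((n%:R ^+ d)^-1)%:E
      * lne (#|` fset_set (language_on (@cube d n) X)|%:R)%:E = (rate n)%:E :> \bar R)%E.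
Proof.
rewrite card_language // lne_EFin ?ltr0n ?blocks_gt0 //.
by rewrite /rate -EFinM mulrC.
Qed.

Lemma entropy_cvg : exists h : R, [/\ 0 <= h, entropy R X = h%:E & rate @ \oo --> h].
Proof.
have [h h0 hc] := rate_cvg; exists h; split=> //.
rewrite /entropy (_ : (fun n => _) = EFin \o rate); last first.
  by apply/funext => n; exact: entropy_rate.
by apply/cvg_lim => //; apply: cvg_EFin => //; exact: nearW.
Qed.
End Upper.
End Entropy.

(** If the sequence defining the entropy of X diverges, its limit is by convention 0,
which is not larger than the entropy of Y. *)
Lemma entropy_gap (R : realType) (d : nat) (d0 : (0 < d)%N) (A B : finType)
    (X : set (config d A)) (Y : set (config d B)) :
  (forall t x, X x -> X (shift_act t x)) ->
  (forall t y, Y y -> Y (shift_act t y)) ->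
  Y !=set0 -> (entropy R Y < entropy R X)%E ->
  exists h2 h1 : R, [/\ 0 <= h2, h2 < h1,
    \forall n \near \oo, ln (#|blocks Y n|%:R : R) <= h2 * n%:R ^+ d
    & \forall n \near \oo, (0 < #|blocks X n|)%N /\
        h1 * n%:R ^+ d <= ln (#|blocks X n|%:R : R)].
Proof.
move=> Xs Ys [y0 Yy0].
have [h [h0 -> hc]] := entropy_cvg R d0 Ys Yy0; move=> hX.
have cX : cvgn (fun n : nat => (((n%:R ^+ d)^-1)%:E
      * lne (#|` fset_set (language_on (@cube d n) X)|%:R)%:E)%E : \bar R).
  apply: contrapT => /dvgP e; move: hX; rewrite /entropy e.
  by rewrite lte_fin ltNge h0.
have [h1 [hh1 h1X]] : exists h1 : R, h < h1 /\ (h1%:E < entropy R X)%E.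
  case: (entropy R X) hX => [r| |] //; last by exists (h + 1); split; [lra|rewrite ltry].
  by rewrite lte_fin => hr; exists ((h + r) / 2); rewrite lte_fin; split; lra.
exists ((h + h1) / 2), h1; split; [lra|lra| |].
  have e0 : 0 < (h1 - h) / 2 by lra.
  move/cvgrPdist_le : hc => /(_ _ e0) hn.
  near=> n; have n0 : (0 < n)%N by near: n; exists 1%N.
  rewrite (lnN_rate R Y n0) ler_wpM2r ?exprn_ge0 //.
  have : `|h - rate R Y n| <= (h1 - h) / 2 by near: n.
  by rewrite ler_norml => /andP[]; lra.
have nb : nbhs (entropy R X) [set y | (h1%:E < y)%E].
  by apply: open_nbhs_nbhs; split => //; exact: open_ereal_gt_ereal.
have big := cX _ nb.
near=> n; have n0 : (0 < n)%N by near: n; exists 1%N.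
have nd0 : 0 < (n%:R : R) ^+ d by rewrite exprn_gt0 // ltr0n.
have : (h1%:E < ((n%:R ^+ d)^-1)%:E
      * lne (#|` fset_set (language_on (@cube d n) X)|%:R)%:E)%E by near: n.
rewrite card_language //; case: (posnP #|blocks X n|) => [->|N0].
  by rewrite le0_lneNy // mulrNy gtr0_sg ?invr_gt0 // mul1e.
rewrite lne_EFin ?ltr0n // -EFinM lte_fin mulrC ltr_pdivlMr // => /ltW lt.
by split.
Unshelve. all: by end_near. Qed.

(** * Choice of the scales *)

Lemma ln_near_le (R : realType) (e c : R) : 0 < e -> 0 < c ->
  \forall i \near \oo, ln (c * i%:R) <= e * i%:R.
Proof.
move=> e0 c0; near=> i.
have i0 : (0 < i)%N by near: i; exists 1%N.
have ir : 0 < (i%:R : R) by rewrite ltr0n.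
have big : 4 * c / e ^+ 2 <= i%:R by near: i; exact: nbhs_infty_ger.
(* exp y >= (1 + y / 2)^2 beats the linear term *)
rewrite -[leRHS]expRK ler_ln ?posrE ?expR_gt0 ?mulr_gt0 //.
set y := e * i%:R; have y0 : 0 <= y by rewrite mulr_ge0 // ltW.
have -> : y = y / 2 + y / 2 by lra.
rewrite expRD; have := expR_ge1Dx (y / 2); set E := expR _ => hE.
apply: (@le_trans _ _ ((y / 2) * (y / 2))); last by apply: ler_pM; lra.
move: big; rewrite ler_pdivrMr ?exprn_gt0 // => big.
have -> : y / 2 * (y / 2) = i%:R * (i%:R * e ^+ 2) / 4 by rewrite /y; field.
by have := ler_wpM2l (ltW ir) big; lra.
Unshelve. all: by end_near. Qed.

(** The left-hand side bounds the logarithm of 3 (2 l)^d |A|^(gap volume) for l at most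
3 i: the gap volume has order i^(d-1), and ln i is o(i). *)
Lemma marker_rate (R : realType) (d g al : nat) (h : R) :
  (0 < d)%N -> 0 < h -> (0 < al)%N ->
  \forall i \near \oo,
    ln 3 + d%:R * ln (6 * i%:R) + (d * g * (3 * i) ^ d.-1)%N%:R * ln al%:R
      <= h * i%:R ^+ d.
Proof.
move=> d0 h0 al0; have dr : 0 < (d%:R : R) by rewrite ltr0n.
have e0 : 0 < h / (2 * d%:R) by rewrite divr_gt0 // mulr_gt0.
have lal : 0 <= ln (al%:R : R) by apply: ln_ge0; rewrite ler1n.
have l3 : 0 <= ln (3 : R) by apply: ln_ge0; lra.
set C : R := ln 3 + (d * g * 3 ^ d.-1)%N%:R * ln al%:R.
near=> i.
have i0 : (0 < i)%N by near: i; exists 1%N.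
have l6 : ln (6 * i%:R) <= h / (2 * d%:R) * i%:R :> R.
  by near: i; apply: ln_near_le => //; lra.
have CI : C * 2 / h <= i%:R by near: i; exact: nbhs_infty_ger.
rewrite ler_pdivrMr // in CI.
set x : R := i%:R ^+ d.-1.
have x1 : 1 <= x by rewrite exprn_ege1 // ler1n.
have -> : i%:R ^+ d = i%:R * x by rewrite /x -exprS prednK.
rewrite expnMn natrM [(3 ^ d.-1 * _)%N%:R]natrM [(i ^ _)%N%:R]natrX -/x.
have {}l6 : d%:R * ln (6 * i%:R) <= h / 2 * i%:R :> R.
  have := ler_wpM2l (ltW dr) l6; rewrite mulrA; congr (_ <= _ * _).
  by field; rewrite ?gt_eqF.
apply: (@le_trans _ _ ((C + h / 2 * i%:R) * x)).
  have a1 : ln 3 <= ln 3 * x :> R by rewrite ler_peMr.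
  have a2 : h / 2 * i%:R <= h / 2 * i%:R * x.
    by rewrite ler_peMr // mulr_ge0 // divr_ge0 // ltW.
  have -> : (d * g)%N%:R * ((3 ^ d.-1)%N%:R * x) * ln al%:R =
     (d * g * 3 ^ d.-1)%N%:R * ln al%:R * x by rewrite [(d * g * _)%N%:R]natrM; ring.
  have -> : (C + h / 2 * i%:R) * x = ln 3 * x + h / 2 * i%:R * x +
      (d * g * 3 ^ d.-1)%N%:R * ln al%:R * x by rewrite /C; ring.
  by rewrite lerD2r lerD // (le_trans l6 a2).
rewrite mulrA ler_wpM2r //; lra.
Unshelve. all: by end_near. Qed.

(** Enlarging cells by a gap of constant width changes their volume by a lower order
term. *)
Lemma content_rate (R : realType) (d g : nat) (c1 c2 c3 : R) :
  (0 < d)%N -> 0 <= c2 -> c2 < c1 ->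
  \forall l \near \oo, c2 * (l + g)%N%:R ^+ d + c3 <= c1 * l%:R ^+ d.
Proof.
move=> d0 c20 c21.
set C : R := (c2 * (d * g * 2 ^ d.-1)%N%:R + `|c3|) / (c1 - c2).
near=> l.
have l0 : (0 < l)%N by near: l; exists 1%N.
have lg : (g <= l)%N by near: l; exists g.
have lC : C <= l%:R by near: l; exact: nbhs_infty_ger.
rewrite ler_pdivrMr ?subr_gt0 // in lC.
set x : R := l%:R ^+ d.-1.
have x1 : 1 <= x by rewrite exprn_ege1 // ler1n.
have le : (l + g)%N%:R ^+ d <= l%:R ^+ d + (d * g * 2 ^ d.-1)%N%:R * x.
  rewrite /x -!natrX -natrM -natrD ler_nat.
  apply: leq_trans (pow_diff d (leq_addr g l)) _.
  rewrite addKn leq_add2l -[leqRHS]mulnA -expnMn leq_mul //.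
  by case: (d.-1) => // d'; rewrite leq_exp2r //; lia.
apply: (@le_trans _ _ (c2 * (l%:R ^+ d + (d * g * 2 ^ d.-1)%N%:R * x) + c3)).
  by rewrite lerD2r ler_wpM2l.
have -> : l%:R ^+ d = l%:R * x by rewrite /x -exprS prednK.
have a1 : c3 <= `|c3| * x.
  by apply: (le_trans (ler_norm c3)); rewrite ler_peMr.
have := ler_wpM2r (le_trans ler01 x1) lC.
rewrite mulrDl mulrBr => h; move: a1; lra.
Unshelve. all: by end_near. Qed.

(** The number a of cells per side is fixed first, so large that losing one cell in a^d
to the marker costs less than the gap between h2 and h1; the factor 4 makes the
period divisible by 4.  Then i is taken large. *)
Lemma scales_exist (R : realType) (d : nat) (h1 h2 : R) (NX NY : nat -> nat)
    (g al T0 : nat) :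
  (0 < d)%N -> (0 < al)%N -> 0 <= h2 -> h2 < h1 ->
  (\forall n \near \oo, ln ((NY n)%:R : R) <= h2 * n%:R ^+ d) ->
  (\forall n \near \oo, (0 < NX n)%N /\ h1 * n%:R ^+ d <= ln ((NX n)%:R : R)) ->
  (forall n, (0 < NY n)%N) ->
  (forall i, (0 < i)%N -> (NX i ^ (2 ^ d) <= NX (i + i + g))%N) ->
  exists i a T, [/\ (0 < i)%N, (0 < a)%N,
    (T0 <= T)%N /\ ((i + i + g + g) * a = 4 * T)%N,
    (3 * (2 ^ d * (i + i + g) ^ d *
       (NX i ^ (2 ^ d - 1) * al ^ ((i + i + g) ^ d - (2 * i) ^ d))) <=
      NX (i + i + g))%N /\ (0 < NX (i + i + g))%N
    & forall G, (NX (i + i + g) <= 2 * G)%N ->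
       (NY ((i + i + g + g) * a) <= G ^ (a ^ d - 1))%N].
Proof.
move=> d0 al0 h20 h21 [nY _ hY] [nX _ hX] NY0 glue.
have h10 : 0 < h1 by lra.
have [a' a'big] : exists a' : nat, h1 / (h1 - h2) < a'%:R.
  exists (Num.truncn (h1 / (h1 - h2))).+1; exact: truncnS_gt.
have a'0 : (0 < a')%N.
  by rewrite -(ltr0n R); apply: le_lt_trans a'big; rewrite divr_ge0 //; lra.
pose a := (4 * a')%N.
have a0 : (0 < a)%N by rewrite /a muln_gt0.
pose c1 := (a ^ d - 1)%N%:R * h1; pose c2 := (a ^ d)%N%:R * h2.
pose c3 := (a ^ d - 1)%N%:R * ln (2 : R).
have aad : (a <= a ^ d)%N by rewrite -{1}(expn1 a) leq_pexp2l.
have c21 : c2 < c1.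
  rewrite /c1 natrB ?expn_gt0 ?a0 // mulrBl mul1r /c2.
  rewrite ltr_pdivrMr ?subr_gt0 // in a'big.
  have : a'%:R * (h1 - h2) <= (a ^ d)%N%:R * (h1 - h2).
    rewrite ler_wpM2r //; first lra.
    by rewrite ler_nat; apply: leq_trans aad; rewrite /a leq_pmull.
  by move: a'big; lra.
have c20 : 0 <= c2 by rewrite mulr_ge0.
have [nl _ hl] := content_rate g c3 d0 c20 c21.
have [ni _ hi] := marker_rate g d0 h10 al0.
have [i ibig] : exists i, (1 + g + T0 + nY + nX + nl + ni <= i)%N by eexists.
have [l lE] : exists l, l = (i + i + g)%N by eexists.
have i0 : (0 < i)%N by lia.
have l0 : (0 < l)%N by lia.
have [NXi hXi] : (0 < NX i)%N /\ h1 * i%:R ^+ d <= ln ((NX i)%:R : R).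
  by apply: hX; rewrite /=; lia.
have [NXl hXl] : (0 < NX l)%N /\ h1 * l%:R ^+ d <= ln ((NX l)%:R : R).
  by apply: hX; rewrite /=; lia.
exists i, a, ((i + g) * 2 * a')%N; rewrite -lE; split=> //.
- split; last by rewrite /a lE; ring.
  by rewrite -mulnA; apply: (@leq_trans (i + g)); [lia|rewrite leq_pmulr // muln_gt0].
- split=> //.
  (* the volume factor and the gap fillings are beaten by a single corner *)
  have key : (3 * (2 ^ d * l ^ d) * al ^ (l ^ d - (2 * i) ^ d) <= NX i)%N.
    have p1 : (0 < 2 * l)%N by rewrite muln_gt0.
    have p2 : (0 < (2 * l) ^ d)%N by rewrite expn_gt0 p1.
    have p3 : (0 < 3 * (2 * l) ^ d)%N by rewrite muln_gt0.
    have [gap gapE] : exists gap, gap = (l ^ d - (2 * i) ^ d)%N by eexists.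
    have p4 : (0 < al ^ gap)%N by rewrite expn_gt0 al0.
    rewrite -gapE -expnMn -(ler_nat R) -ler_ln ?posrE ?ltr0n //; last by rewrite muln_gt0 p3 p4.
    have -> : ln ((3 * (2 * l) ^ d * al ^ gap)%N%:R : R) =
        ln 3 + ln (2 * l)%N%:R *+ d + ln al%:R *+ gap.
      rewrite natrM lnM ?posrE ?ltr0n // natrM lnM ?posrE ?ltr0n //.
      by rewrite !natrX !lnXn ?ltr0n.
    apply: le_trans hXi; apply: le_trans (hi i _); last by rewrite /=; lia.
    rewrite -[ln _ *+ d]mulr_natl -[ln _ *+ gap]mulr_natl lerD ?lerD //.
      rewrite ler_wpM2l // ler_ln ?posrE ?ltr0n ?mulr_gt0 ?ltr0n //.
      by rewrite -natrM ler_nat; lia.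
    rewrite ler_wpM2r ?ln_ge0 ?ler1n // ler_nat gapE leq_subLR.
    have li : (2 * i <= l)%N by lia.
    apply: leq_trans (pow_diff d li) _; rewrite leq_add2l.
    have -> : (l - 2 * i = g)%N by lia.
    rewrite leq_mul //; case: (d.-1) => // d'; rewrite leq_exp2r //; lia.
  rewrite lE; apply: leq_trans (glue i i0); rewrite -lE.
  have -> : (NX i ^ 2 ^ d = NX i * NX i ^ (2 ^ d - 1))%N.
    by rewrite -expnS subn1 prednK ?expn_gt0.
  apply: leq_trans (leq_mul key (leqnn _)); apply: eq_leq.
  by move: (2 ^ d * l ^ d)%N (_ ^ _)%N (al ^ _)%N => u1 u2 u3; ring.
- move=> G hG.
  have G0 : (0 < G)%N by lia.
  rewrite -(ler_nat R) -ler_ln ?posrE ?ltr0n ?expn_gt0 ?G0 ?NY0 //.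
  apply: le_trans (hY _ _) _.
    by rewrite /=; apply: (@leq_trans i); [lia|nia].
  rewrite natrX lnXn ?ltr0n // natrM exprMn -[ln _ *+ _]mulr_natl.
  have lnG : h1 * l%:R ^+ d - ln 2 <= ln G%:R.
    apply: le_trans (_ : ln ((NX l)%:R) - ln 2 <= _); first by rewrite lerD2r.
    rewrite lerBlDr addrC -lnM ?posrE ?ltr0n // ler_ln ?posrE ?ltr0n ?mulr_gt0 ?ltr0n //.
    by rewrite -natrM ler_nat.
  apply: le_trans (ler_wpM2l (ler0n _ _) lnG).
  have H : c2 * (l + g)%N%:R ^+ d + c3 <= c1 * l%:R ^+ d by apply: hl; rewrite /=; lia.
  have E1 : c1 * l%:R ^+ d = (a ^ d - 1)%N%:R * (h1 * l%:R ^+ d) by rewrite /c1 mulrA.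
  rewrite mulrBr lerBrDr -E1; apply: le_trans _ H.
  rewrite lerD2r /c2 natrX; move: ((l + g)%N%:R ^+ d) (a%:R ^+ d) => u1 u2.
  by have -> : h2 * (u1 * u2) = u2 * h2 * u1 by ring.
Qed.

(** * The factor map *)

(** The 2^d corners of a block can be prescribed independently. *)
Lemma blocks_supermul d (A : finType) (X : set (config d A)) g i :
  (forall t x, X x -> X (shift_act t x)) ->
  (forall u : lattice d -> config d A, (forall v, X (u v)) ->
    exists2 x, X x & forall v s, cube i s -> x (v *+ (i + g) + s) = u v s) ->
  X !=set0 ->
  (#|blocks X i| ^ (2 ^ d) <= #|blocks X (i + i + g)|)%N.
Proof.
move=> Xs Xgrid [x0 Xx0].
apply: (@card_blocks_ge d A X 2 i (i + g) (i + i + g) (@corner_lt i g)) => f fX.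
have exu (v : lattice d) : exists x, X x /\ forall c, v = emb c -> block_of x i 0 = f c.
  have [[c ->]|/forallNP no] := pselect (exists c : idx d 2, v = emb c).
    have /blocksP[x Xx xf] := fX c; exists x; split=> // c' /emb_inj <-; exact: xf.
  by exists x0; split=> // c /no.
have [u uP] := choice exu.
have [x Xx xP] := Xgrid u (fun v => proj1 (uP v)).
exists (block_of x (i + i + g) 0); first exact: block_in.
move=> c; rewrite -(proj2 (uP (emb c)) c erefl); apply/ffunP => s.
by rewrite !ffunE !add0r emb_pos xP //; exact: emb_cube.
Qed.

Theorem theorem1p6 (R : realType) (d : nat) (A B : finType)
    (X : set (config d A)) (Y : set (config d B)) :
  (0 < d)%N ->
  subshift X -> block_gluing X ->
  sft Y -> (exists y, fixed_point Y y) -> finite_extension_property Y ->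
  (entropy R Y < entropy R X)%E ->
  exists phi : config d A -> config d B, factor_map X Y phi.
Proof.
move=> d0 [Xcl Xs] [_ [g Xglue]] [[_ Ys] _] [y0 [Yy0 y0fix]].
move=> [_ [g2 [F [[finF finshape] YF Yext]]]] hent.
pose b0 := y0 0.
have y0E : y0 = (fun=> b0).
  by apply/funext => s; rewrite /b0 -{2}(y0fix s) /shift_act add0r.
have Yb0 : Y (fun=> b0) by rewrite -y0E.
have [D FD] : exists D, forall f s, F f -> f s <> None -> inQ D s.
  have [|D hD] := @finite_inQ d (\bigcup_(f in F) Defs.shape f).
    exact: bigcup_finite.
  by exists D => f s Ff fs; apply: hD; exists f => //; apply/eqP.
have [T0 corr] := correction_exists YF FD Yb0 Yext Ys A.
have [h2 [h1 [h20 h21 hY hX]]] := entropy_gap d0 Xs Ys (ex_intro _ y0 Yy0) hent.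
have [x0 Xx0] : X !=set0.
  have [n _ /(_ n (leqnn n))[N0 _]] := hX.
  by move/card_gt0P : N0 => [b /blocksP[x Xx _]]; exists x.
have a0 := x0 0.
have al0 : (0 < #|A|)%N by apply/card_gt0P; exists a0.
have Xgrid l : (0 < l)%N -> forall u : lattice d -> config d A, (forall v, X (u v)) ->
    exists2 x, X x & forall v s, cube l s -> x (v *+ (l + g) + s) = u v s.
  by move=> l0 u; exact: grid_gluing.
have glue i : (0 < i)%N -> (#|blocks X i| ^ (2 ^ d) <= #|blocks X (i + i + g)|)%N.
  by move=> i0; apply: blocks_supermul => //; [exact: Xgrid|exists x0].
have NY0 n : (0 < #|blocks Y n|)%N by exact: blocks_gt0 Yy0 n.
have [i [a [T [i0 a_gt0 [T0T nT] [le3 Nl0] bound]]]] :=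
  scales_exist T0 d0 al0 h20 h21 hY hX NY0 glue.
have [P [Pin Pself /bound count]] := marker_exists Xs a0 le3 Nl0.
have [dec decP] := decoder_exists b0 Ys a_gt0 count.
have l0 : (0 < i + i + g)%N by rewrite addn_gt0 addn_gt0 i0.
have [C [Csbc Cin Cid]] := corr T T0T.
pose M := marker a P; pose w := decoded P b0 dec.
have sepM x v v' : M x v -> M x v' -> inQ (4 * T).-1 (v - v') -> v = v'.
  by rewrite -nT; exact: marker_separated.
have nearM x s : w x s <> b0 -> exists2 v, M x v & inQ (4 * T) (s - v).
  by rewrite -nT; exact: decoded_near.
pose phi (x : config d A) : config d B := C (M x) (w x).
have phi_sbc : sbc phi by apply: Csbc; [exact: marker_sbc|exact: decoded_sbc].
exists phi; split.
- by apply: continuous_subspaceT => x; exact: sbc_continuous.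
- apply/seteqP; split=> [_ [x Xx <-]|y Yy].
    by apply: Cin => [v v'|s]; [exact: sepM|exact: nearM].
  have [x Xx wx] := decoded_onto b0 Ys a_gt0 i0 (Xgrid _ l0) Pin Pself decP Yy.
  exists x => //; rewrite /phi /w wx; apply: Cid Yy; exact: sepM.
- by move=> t x _; exact: sbc_shift.
Qed.
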